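(* ($\mathrm{BZFC}$) BS4 is sound and complete with respect to Tarski semantics. That is, $\mathrm{BZFC}$ proves (in BS4): for every set of formulas $\Sigma$ and every formula $\varphi$ (of a first-order vocabulary without function symbols), $$\Sigma\models\varphi\ \leftrightarrow\ \Sigma\vdash_{BS4}\varphi,$$ where $\models$ is the Tarski semantic consequence relation.
   Context: LOGIC BS4. BS4 is a four-valued first-order logic with primitive symbols $\sim$ (native negation), $\wedge,\vee,\to,\bot,\forall,\exists,=$; $\varphi\leftrightarrow\psi$ is $(\varphi\to\psi)\wedge(\psi\to\varphi)$. Vocabularies contain only constant and relation symbols. A T/F-model $\mathcal M$ has a (nonempty) domain $M$, an element $c^{\mathcal M}\in M$ for each constant, for each $n$-ary relation symbol $R$ two sets $(R^{\mathcal M})^+,(R^{\mathcal M})^-\subseteq M^n$ (with no relation assumed between them), the relation $=^+$ which is true identity on $M$, and a symmetric binary relation $=^-$ on $M$. Truth $\models^T$ and falsity $\models^F$ are defined recursively: an atomic formula is true iff its $+$ interpretation holds and false iff its $-$ interpretation holds; $\sim\varphi$ is true iff $\varphi$ is false, and false iff $\varphi$ is true; $\varphi\wedge\psi$ is true iff both are true, false iff at least one is false; $\varphi\vee\psi$ is true iff at least one is true, false iff both are false; $\varphi\to\psi$ is true iff ($\varphi$ true implies $\psi$ true), false iff $\varphi$ is true and $\psi$ is false; $\exists x\varphi$ is true iff some instance is true, false iff all instances are false; $\forall x\varphi$ is true iff all instances are true, false iff some instance is false; $\bot$ is never true and always false. $\Sigma\vdash_{BS4}\varphi$ means: for every T/F-model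 $\mathcal M$, if $\mathcal M\models^T\Sigma$ then $\mathcal M\models^T\varphi$ (there is a sound and complete Hilbert calculus for this relation). ABBREVIATIONS. $\varphi\Rightarrow\psi$ is $(\varphi\to\psi)\wedge(\sim\psi\to\sim\varphi)$; $\varphi\Leftrightarrow\psi$ is $(\varphi\leftrightarrow\psi)\wedge(\sim\varphi\leftrightarrow\sim\psi)$; $\neg\varphi$ is $\varphi\to\bot$; $!\varphi$ is $\sim\neg\varphi$; $?\varphi$ is $\neg\sim\varphi$; $\circ\varphi$ is $!\varphi\leftrightarrow{?}\varphi$ (''$\varphi$ is classical''). $x\neq y$, $x\notin y$, $x\not\subseteq y$ are $\sim(x=y)$, $\sim(x\in y)$, $\sim(x\subseteq y)$. SETS. The language of set theory is $\{\in\}$. $x=\{y:\varphi(y)\}$ abbreviates $\forall y(y\in x\Leftrightarrow\varphi(y))$. $x\subseteq y$ is $\forall z(z\in x\Rightarrow z\in y)$. $x^!=\{y:{!}(y\in x)\}$, $x^?=\{y:{?}(y\in x)\}$. A set $x$ is classical if $\forall y(y\in x^!\leftrightarrow y\in x^?)$. $\{u_0,\dots,u_n\}=\{y:{!}(y=u_0)\vee\dots\vee{!}(y=u_n)\}$. $\langle u,v\rangle=\{\{u\},\{u,v\}\}$; the ordered pair $(a,b)$ is the set with $(a,b)^!=\{\langle x,\varnothing\rangle:x\in a^!\}\cup\{\langle y,\{\varnothing\}\rangle:y\in b^!\}$ and $(a,b)^?$ given likewise from $a^?,b^?$. $A\times B=\{(a,b):a\in A\wedge b\in B\}$; $\mathrm{dom}(R)=\{x:\exists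 y\,(x,y)\in R\}$. For a classical set $A$, a classical function from $A$ to $B$ is a classical set $f\subseteq A\times B$ with $\mathrm{dom}(f)=A$ and $\forall x\forall y\forall z(((x,y)\in f\wedge(x,z)\in f)\to{!}(y=z))$. AXIOMS OF PZFC (in BS4; schemas for all formulas $\varphi$, with parameters). Extensionality: $\forall x\forall y(x=y\Leftrightarrow\forall z(z\in x\Leftrightarrow z\in y))$. Comprehension: $\forall u\exists x\forall y(y\in x\Leftrightarrow(y\in u\wedge\varphi(y)))$. Classical Superset: $\forall x\exists C(x\subseteq C\wedge\forall y\,{\circ}(y\in C))$. Replacement: $[\forall x\forall y\,{\circ}\varphi(x,y)\wedge\forall x\exists y(\varphi(x,y)\wedge\forall z(\varphi(x,z)\to{!}(y=z)))]\to\forall x\exists y\forall z(z\in y\Leftrightarrow\exists w(w\in x\wedge\varphi(w,z)))$. Pairing: $\forall u\forall v\exists x\forall y(y\in x\Leftrightarrow({!}(y=u)\vee{!}(y=v)))$. Power Set: $\forall u\exists v\forall x(x\in v\Leftrightarrow{!}(x\subseteq u))$. Union: $\forall u\exists x\forall y(y\in x\Leftrightarrow\exists z(y\in z\wedge z\in u))$. Infinity: $\exists x(\varnothing\in x\wedge\forall y(y\in x\to y\cup\{y\}\in x))$. Foundation: $\forall x(\forall y(y\in x^!\cup x^?\to\varphi(y))\to\varphi(x))\to\forall u\,\varphi(u)$. Choice: for every classical $u$, if $\forall x(x\in u\to\exists y(y\in x))$ then there is a classical function $f$ with $\mathrm{dom}(f)=u$ and $f(x)\in x$ for all $x\in u$.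 ACLA: $\exists x(x^!\not\subseteq x^?)\wedge\exists x(x^?\not\subseteq x^!)$. $\mathrm{BZFC}$ is $\mathrm{PZFC}+\mathrm{ACLA}$. SEMANTICS INSIDE PZFC. First-order syntax (with $\sim,\wedge,\vee,\to,\bot,\forall,\exists,=$; no function symbols) is coded by classical sets. A Tarski model $\mathcal M$ consists of a classical set $M$ as domain and (not necessarily classical) interpretations for all constant and relation symbols ($R^{\mathcal M}\subseteq M^n$). Satisfaction is defined recursively, all equivalences being strong ($\Leftrightarrow$), with the logical words on the right being those of the BS4 meta-theory: $\mathcal M\models(t=s)[a,b]\Leftrightarrow a=b$; $\mathcal M\models R(t_1,\dots,t_n)[a_1,\dots,a_n]\Leftrightarrow R^{\mathcal M}(a_1,\dots,a_n)$; $\mathcal M\models{\sim}\varphi\Leftrightarrow{\sim}(\mathcal M\models\varphi)$; $\mathcal M\models\varphi\wedge\psi\Leftrightarrow(\mathcal M\models\varphi\wedge\mathcal M\models\psi)$, and similarly for $\vee,\to,\leftrightarrow$; $\mathcal M\models\exists x\varphi(x)\Leftrightarrow\mathcal M\models\varphi[a]$ for some $a\in M$; $\mathcal M\models\forall x\varphi(x)\Leftrightarrow\mathcal M\models\varphi[a]$ for all $a\in M$; $\mathcal M\models\bot\Leftrightarrow\bot$. Tarski consequence: $\Sigma\models\varphi$ iff for every Tarski model $\mathcal M$, $\mathcal M\models\Sigma\to\mathcal M\models\varphi$. Inside PZFC, a T/F-model $\mathcal M$ has a (nonempty) classical set $M$ as domain, an element $c^{\mathcal M}\in M$ for each constant,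 for each $n$-ary relation symbol $R$ two classical subsets $(R^{\mathcal M})^+,(R^{\mathcal M})^-$ of $M^n$ (with no relation assumed between them), and classical subsets $=^+$ and $=^-$ of $M\times M$, where $=^-$ is symmetric and $a=^+b\leftrightarrow{!}(a=b)$ for $a,b\in M$. The classical relations $\mathcal M\models^T\varphi$ and $\mathcal M\models^F\varphi$ are defined recursively: for atomic $\varphi$, $\mathcal M\models^T\varphi$ iff its $+$ interpretation holds, and $\mathcal M\models^F\varphi$ iff its $-$ interpretation holds; $\mathcal M\models^T{\sim}\varphi$ iff $\mathcal M\models^F\varphi$, and $\mathcal M\models^F{\sim}\varphi$ iff $\mathcal M\models^T\varphi$; $\mathcal M\models^T\varphi\wedge\psi$ iff $\mathcal M\models^T\varphi$ and $\mathcal M\models^T\psi$, and $\mathcal M\models^F\varphi\wedge\psi$ iff $\mathcal M\models^F\varphi$ or $\mathcal M\models^F\psi$; $\mathcal M\models^T\varphi\vee\psi$ iff $\mathcal M\models^T\varphi$ or $\mathcal M\models^T\psi$, and $\mathcal M\models^F\varphi\vee\psi$ iff $\mathcal M\models^F\varphi$ and $\mathcal M\models^F\psi$; $\mathcal M\models^T\varphi\to\psi$ iff ($\mathcal M\models^T\varphi$ implies $\mathcal M\models^T\psi$), and $\mathcal M\models^F\varphi\to\psi$ iff $\mathcal M\models^T\varphi$ and $\mathcal M\models^F\psi$; $\mathcal M\models^T\exists x\varphi(x)$ iff $\mathcal M\models^T\varphi[a]$ for some $a\in M$, and $\mathcal M\models^F\exists x\varphi(x)$ iff $\mathcal M\models^F\varphi[a]$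 for all $a\in M$; $\mathcal M\models^T\forall x\varphi(x)$ iff $\mathcal M\models^T\varphi[a]$ for all $a\in M$, and $\mathcal M\models^F\forall x\varphi(x)$ iff $\mathcal M\models^F\varphi[a]$ for some $a\in M$; $\mathcal M\models^T\bot$ never holds and $\mathcal M\models^F\bot$ always holds. The relation $\Sigma\vdash_{BS4}\varphi$ inside PZFC is the T/F-semantic consequence relation: for every such T/F-model $\mathcal M$, if $\mathcal M\models^T\Sigma$ then $\mathcal M\models^T\varphi$. *)

(* Defs.v *)
From Stdlib Require Import List.
Set Implicit Arguments.

(** * BS4 over the vocabulary {∈} *)

(* De Bruijn indices; BS4 vocabularies have no function symbols and {∈} has no
   constants, so variables are the only terms. *)
Inductive form : Type :=
| Mem (x y : nat)
| Eql (x y : nat)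
| Bot
| Neg (A : form)
| And (A B : form)
| Or (A B : form)
| Imp (A B : form)
| All (A : form)
| Ex (A : form).

Record tf_model : Type := {
  carrier :> Type;
  carrier_inhabited : inhabited carrier;
  mem_pos : carrier -> carrier -> Prop;
  mem_neg : carrier -> carrier -> Prop;
  eql_neg : carrier -> carrier -> Prop;
  eql_neg_sym : forall a b, eql_neg a b -> eql_neg b a
}.

Definition scons (T : Type) (a : T) (e : nat -> T) (n : nat) : T :=
  match n with O => a | S m => e m end.

Fixpoint tr (M : tf_model) (e : nat -> M) (A : form) {struct A} : Prop :=
  match A with
  | Mem x y => mem_pos M (e x) (e y)
  | Eql x y => e x = e y
  | Bot => False
  | Neg B => fl M e B
  | And B C => tr M e B /\ tr M e C
  | Or B C => tr M e B \/ tr M e C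
  | Imp B C => tr M e B -> tr M e C
  | All B => forall a, tr M (scons a e) B
  | Ex B => exists a, tr M (scons a e) B
  end
with fl (M : tf_model) (e : nat -> M) (A : form) {struct A} : Prop :=
  match A with
  | Mem x y => mem_neg M (e x) (e y)
  | Eql x y => eql_neg M (e x) (e y)
  | Bot => True
  | Neg B => tr M e B
  | And B C => fl M e B \/ fl M e C
  | Or B C => fl M e B /\ fl M e C
  | Imp B C => tr M e B /\ fl M e C
  | All B => exists a, fl M (scons a e) B
  | Ex B => forall a, fl M (scons a e) B
  end.

(* An open formula stands for its universal closure. *)
Definition valid (M : tf_model) (A : form) : Prop := forall e : nat -> M, tr M e A.

Definition BS4_proves (Sigma : form -> Prop) (A : form) : Prop :=
  forall M : tf_model, (forall B, Sigma B -> valid M B) -> valid M A.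

(** * Writing formulas with named binders *)

(* A [bform] is a formula under construction: it maps the number [d] of
   enclosing quantifiers to a formula.  A variable is named by its de Bruijn
   level, i.e. the number of quantifiers enclosing its own binder, so that it
   does not change when one goes under further binders; the level [x] is the
   index [d - 1 - x] under [d] quantifiers. *)
Definition var := nat.
Definition bform := nat -> form.
Definition ix (d : nat) (x : var) : nat := d - 1 - x.

Definition bmem (x y : var) : bform := fun d => Mem (ix d x) (ix d y).
Definition beql (x y : var) : bform := fun d => Eql (ix d x) (ix d y).
Definition bbot : bform := fun _ => Bot.
Definition bneg (A : bform) : bform := fun d => Neg (A d).
Definition band (A B : bform) : bform := fun d => And (A d) (B d).
Definition bor (A B : bform) : bform := fun d => Or (A d) (B d).
Definition bimp (A B : bform) : bform := fun d => Imp (A d) (B d).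
Definition ball (A : var -> bform) : bform := fun d => All (A d (S d)).
Definition bex (A : var -> bform) : bform := fun d => Ex (A d (S d)).

Definition close (A : bform) : form := A 0.

Declare Scope bs4_scope.
Delimit Scope bs4_scope with bs4.
Bind Scope bs4_scope with bform.

Notation "x ∈ y" := (bmem x y) (at level 70, no associativity) : bs4_scope.
Notation "x ≡ y" := (beql x y) (at level 70, no associativity) : bs4_scope.
Notation "⊥" := bbot : bs4_scope.
Notation "∼ A" := (bneg A) (at level 75, right associativity) : bs4_scope.
Notation "A ⊓ B" := (band A B) (at level 80, right associativity) : bs4_scope.
Notation "A ⊔ B" := (bor A B) (at level 85, right associativity) : bs4_scope.
Notation "A ⟶ B" := (bimp A B) (at level 90, right associativity) : bs4_scope.
Notation "'∀' x .. y , A" := (ball (fun x => .. (ball (fun y => A)) ..))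
  (at level 200, x binder, y binder, right associativity) : bs4_scope.
Notation "'∃' x .. y , A" := (bex (fun x => .. (bex (fun y => A)) ..))
  (at level 200, x binder, y binder, right associativity) : bs4_scope.
Open Scope bs4_scope.

Definition biff (A B : bform) : bform := (A ⟶ B) ⊓ (B ⟶ A).
Notation "A ⟷ B" := (biff A B) (at level 95, no associativity) : bs4_scope.
Definition bsimp (A B : bform) : bform := (A ⟶ B) ⊓ (∼ B ⟶ ∼ A).
Notation "A ⟹ B" := (bsimp A B) (at level 95, no associativity) : bs4_scope.
Definition bsiff (A B : bform) : bform := (A ⟷ B) ⊓ (∼ A ⟷ ∼ B).
Notation "A ⟺ B" := (bsiff A B) (at level 95, no associativity) : bs4_scope.

Definition cneg (A : bform) : bform := A ⟶ ⊥.
Definition bang (A : bform) : bform := ∼ cneg A.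
Definition quest (A : bform) : bform := cneg (∼ A).
Definition circ (A : bform) : bform := bang A ⟷ quest A.

Fixpoint rename (r : nat -> nat) (A : form) : form :=
  match A with
  | Mem x y => Mem (r x) (r y)
  | Eql x y => Eql (r x) (r y)
  | Bot => Bot
  | Neg B => Neg (rename r B)
  | And B C => And (rename r B) (rename r C)
  | Or B C => Or (rename r B) (rename r C)
  | Imp B C => Imp (rename r B) (rename r C)
  | All B => All (rename (scons 0 (fun n => S (r n))) B)
  | Ex B => Ex (rename (scons 0 (fun n => S (r n))) B)
  end.

(* φ(x₁,…,xₙ) for the metavariable φ of an axiom schema: the indices 0, …, n-1
   of φ are its displayed arguments, all further ones are parameters, which
   remain free in the instance of the schema. *)
Definition inst (phi : form) (args : list var) : bform := fun d =>
  rename (fun i => match nth_error args i with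
                   | Some x => ix d x
                   | None => d + (i - length args)
                   end) phi.

(** * Class terms *)

(* [cls] represents {y : φ(y)}.  Class terms are eliminated as follows:
   - y ∈ {y : φ(y)} is φ(y);
   - x = {y : φ(y)} is ∀ y (y ∈ x ⇔ φ(y));
   - in any other context ψ, the term denotes the unique such set, so that
     ψ({y : φ(y)}) has the truth and the falsity value of ψ(s) for that s; this
     is [the].  The [bang] makes the formula false exactly if ψ(s) is.
   Likewise {t(a) : φ(a)} is {z : ∃ a (!(z = t(a)) ∧ φ(a))}; without the [!],
   products of classical sets would fail to be classical. *)
Definition cls := var -> bform.
Definition elts (x : var) : cls := fun y => y ∈ x.
Definition is_set (x : var) (A : cls) : bform := ∀ y, y ∈ x ⟺ A y.
Definition the (A : cls) (psi : var -> bform) : bform :=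
  ∃ s, bang (is_set s A) ⊓ psi s.
Definition subcls (A B : cls) : bform := ∀ z, A z ⟹ B z.
Definition subset (x y : var) : bform := subcls (elts x) (elts y).

Definition bang_part (x : var) : cls := fun y => bang (y ∈ x).
Definition quest_part (x : var) : cls := fun y => quest (y ∈ x).
Definition classical (x : var) : bform := ∀ y, bang_part x y ⟷ quest_part x y.

Definition empty : cls := fun _ => ⊥.
Definition sing (u : var) : cls := fun y => bang (y ≡ u).
Definition upair (u v : var) : cls := fun y => bang (y ≡ u) ⊔ bang (y ≡ v).
Definition succ (x : var) : cls := fun z => z ∈ x ⊔ sing x z.

(* ⟨u,v⟩ *)
Definition kpair (u v : var) : cls := fun y =>
  bang (is_set y (sing u)) ⊔ bang (is_set y (upair u v)).

(* {⟨x,∅⟩ : x ∈ A} ∪ {⟨y,{∅}⟩ : y ∈ B} *)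
Definition tagged_union (A B : cls) : cls := fun z =>
  (∃ x, (the empty (fun e => bang (is_set z (kpair x e)))) ⊓ A x)
  ⊔ (∃ y, (the empty (fun e => the (sing e) (fun o =>
            bang (is_set z (kpair y o))))) ⊓ B y).

(* p = (a,b) *)
Definition is_opair (p a b : var) : bform :=
  (∀ z, bang_part p z ⟺ tagged_union (bang_part a) (bang_part b) z)
  ⊓ (∀ z, quest_part p z ⟺ tagged_union (quest_part a) (quest_part b) z).

(* (a,b) ∈ R *)
Definition opair_in (a b R : var) : bform := ∃ p, bang (is_opair p a b) ⊓ p ∈ R.

Definition prod (A B : var) : cls := fun z =>
  ∃ a b, bang (is_opair z a b) ⊓ a ∈ A ⊓ b ∈ B.
Definition dom (R : var) : cls := fun x => ∃ y, opair_in x y R.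

(* f is a classical function from A to B *)
Definition cfun (f A B : var) : bform :=
  classical f ⊓ subcls (elts f) (prod A B) ⊓ is_set A (dom f)
  ⊓ ∀ x y z, (opair_in x y f ⊓ opair_in x z f) ⟶ bang (y ≡ z).

(* f is a classical function with domain A *)
Definition cfun_on (f A : var) : bform := ∃ B, cfun f A B.

Definition inductive (I : var) : bform :=
  the empty (fun e => e ∈ I) ⊓ ∀ y, y ∈ I ⟶ the (succ y) (fun s => s ∈ I).

(** * The theories PZFC and BZFC *)

Definition ax_extensionality : bform :=
  ∀ x y, x ≡ y ⟺ (∀ z, z ∈ x ⟺ z ∈ y).
Definition ax_comprehension (phi : form) : bform :=
  ∀ u, ∃ x, ∀ y, y ∈ x ⟺ (y ∈ u ⊓ inst phi (y :: nil)).
Definition ax_classical_superset : bform :=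
  ∀ x, ∃ C, subset x C ⊓ ∀ y, circ (y ∈ C).
Definition ax_replacement (phi : form) : bform :=
  ((∀ x y, circ (inst phi (x :: y :: nil)))
   ⊓ ∀ x, ∃ y, inst phi (x :: y :: nil)
               ⊓ ∀ z, inst phi (x :: z :: nil) ⟶ bang (y ≡ z))
  ⟶ ∀ x, ∃ y, ∀ z, z ∈ y ⟺ (∃ w, w ∈ x ⊓ inst phi (w :: z :: nil)).
Definition ax_pairing : bform := ∀ u v, ∃ x, is_set x (upair u v).
Definition ax_power_set : bform := ∀ u, ∃ v, ∀ x, x ∈ v ⟺ bang (subset x u).
Definition ax_union : bform := ∀ u, ∃ x, ∀ y, y ∈ x ⟺ (∃ z, y ∈ z ⊓ z ∈ u).
Definition ax_infinity : bform := ∃ x, inductive x.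
Definition ax_foundation (phi : form) : bform :=
  (∀ x, (∀ y, (bang_part x y ⊔ quest_part x y) ⟶ inst phi (y :: nil))
        ⟶ inst phi (x :: nil))
  ⟶ ∀ u, inst phi (u :: nil).
Definition ax_choice : bform :=
  ∀ u, classical u ⟶ (∀ x, x ∈ u ⟶ ∃ y, y ∈ x) ⟶
  ∃ f, cfun_on f u ⊓ ∀ x, x ∈ u ⟶ ∃ y, opair_in x y f ⊓ y ∈ x.
Definition ax_ACLA : bform :=
  (∃ x, ∼ subcls (bang_part x) (quest_part x))
  ⊓ (∃ x, ∼ subcls (quest_part x) (bang_part x)).

Inductive PZFC : form -> Prop :=
| PZFC_extensionality : PZFC (close ax_extensionality)
| PZFC_comprehension phi : PZFC (close (ax_comprehension phi))
| PZFC_classical_superset : PZFC (close ax_classical_superset)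
| PZFC_replacement phi : PZFC (close (ax_replacement phi))
| PZFC_pairing : PZFC (close ax_pairing)
| PZFC_power_set : PZFC (close ax_power_set)
| PZFC_union : PZFC (close ax_union)
| PZFC_infinity : PZFC (close ax_infinity)
| PZFC_foundation phi : PZFC (close (ax_foundation phi))
| PZFC_choice : PZFC (close ax_choice).

Inductive BZFC : form -> Prop :=
| BZFC_PZFC A : PZFC A -> BZFC A
| BZFC_ACLA : BZFC (close ax_ACLA).

(** * First-order syntax inside PZFC *)

Definition omega : cls := fun n => bang (∀ I, inductive I ⟶ n ∈ I).

Fixpoint numeral (k : nat) : cls :=
  match k with
  | O => empty
  | S j => fun z => the (numeral j) (fun x => succ x z)
  end.

(* A vocabulary: a classical set [C] of constant symbols, a classical set [P] of
   relation symbols and the arity function [ar]. *)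
Definition vocabulary (C P ar : var) : bform :=
  classical C ⊓ classical P ⊓ the omega (fun w => cfun ar P w).

(* Terms are v_n = ⟨0,n⟩ for n ∈ ω and ⟨1,c⟩ for c ∈ C. *)
Definition is_tvar (n t : var) : bform :=
  the (numeral 0) (fun k => is_set t (kpair k n)).
Definition is_tcon (c t : var) : bform :=
  the (numeral 1) (fun k => is_set t (kpair k c)).
Definition term (C : var) : cls := fun t =>
  bang ((∃ n, omega n ⊓ is_tvar n t) ⊔ (∃ c, c ∈ C ⊓ is_tcon c t)).

(* w = ⟨k,⟨u,v⟩⟩ *)
Definition is_code (k : nat) (u v w : var) : bform :=
  the (numeral k) (fun i => the (kpair u v) (fun p => is_set w (kpair i p))).

(* [w] is the code of: s = t; R(ts), where ts is the sequence of arguments; ⊥;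
   ∼p; p ∧ q; p ∨ q; p → q; ∀ v_n p; ∃ v_n p. *)
Definition is_eql (s t w : var) : bform := is_code 0 s t w.
Definition is_rel (R ts w : var) : bform := is_code 1 R ts w.
Definition is_bot (w : var) : bform := the empty (fun e => is_code 2 e e w).
Definition is_neg (p w : var) : bform := is_code 3 p p w.
Definition is_and (p q w : var) : bform := is_code 4 p q w.
Definition is_or (p q w : var) : bform := is_code 5 p q w.
Definition is_imp (p q w : var) : bform := is_code 6 p q w.
Definition is_all (n p w : var) : bform := is_code 7 n p w.
Definition is_ex (n p w : var) : bform := is_code 8 n p w.

(* ts is a sequence of terms whose length is the arity of R *)
Definition arguments (C P ar R ts : var) : bform :=
  R ∈ P ⊓ ∃ n, opair_in R n ar ⊓ the (term C) (fun TS => cfun ts n TS).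

Definition formula_closed (C P ar X : var) : bform :=
  (∀ s t w, term C s ⟶ term C t ⟶ is_eql s t w ⟶ w ∈ X)
  ⊓ (∀ R ts w, arguments C P ar R ts ⟶ is_rel R ts w ⟶ w ∈ X)
  ⊓ (∀ w, is_bot w ⟶ w ∈ X)
  ⊓ (∀ p w, p ∈ X ⟶ is_neg p w ⟶ w ∈ X)
  ⊓ (∀ p q w, p ∈ X ⟶ q ∈ X ⟶ (is_and p q w ⊔ is_or p q w ⊔ is_imp p q w) ⟶ w ∈ X)
  ⊓ (∀ n p w, omega n ⟶ p ∈ X ⟶ (is_all n p w ⊔ is_ex n p w) ⟶ w ∈ X).

Definition formula (C P ar : var) : cls := fun w =>
  bang (∀ X, formula_closed C P ar X ⟶ w ∈ X).

(** * Semantics inside PZFC *)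

(* Mⁿ, as the classical functions from n = {0, …, n-1} to M *)
Definition power (M n : var) : cls := fun z => bang (cfun z n M).

Definition assignment (M a : var) : bform := the omega (fun w => cfun a w M).

(* a' = a[n ↦ m] *)
Definition is_update (M a n m a' : var) : bform :=
  assignment M a'
  ⊓ ∀ k x, omega k ⟶
      (opair_in k x a' ⟷
       ((bang (k ≡ n) ⊓ bang (x ≡ m)) ⊔ (cneg (k ≡ n) ⊓ opair_in k x a))).

Definition the_update (M a n m : var) (psi : var -> bform) : bform :=
  ∃ a', bang (is_update M a n m a') ⊓ psi a'.

(* x is the value of the term t under the constant interpretation c and the
   assignment a *)
Definition value (c a t x : var) : bform :=
  (∃ n, omega n ⊓ is_tvar n t ⊓ opair_in n x a)
  ⊔ (∃ k, is_tcon k t ⊓ opair_in k x c).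

(* b = (b_0, …, b_{n-1}) ∈ Mⁿ consists of the values of the terms in ts, where n
   is the arity of R *)
Definition values (M ar c a R ts b : var) : bform :=
  ∃ n, opair_in R n ar ⊓ power M n b
       ⊓ ∀ i t x, opair_in i t ts ⟶ opair_in i x b ⟶ value c a t x.

Definition domain (M : var) : bform := classical M ⊓ ∃ m, m ∈ M.

(** ** Tarski semantics *)

(* The Tarski model has domain M, constant interpretation c and relation
   interpretation r, a classical function whose values r(R) ⊆ Mⁿ need not be
   classical. *)
Definition tarski_model (C P ar M c r : var) : bform :=
  domain M ⊓ cfun c C M ⊓ cfun_on r P
  ⊓ ∀ R n i, opair_in R n ar ⟶ opair_in R i r ⟶ subcls (elts i) (power M n).

(* Sat satisfies the recursion clauses of Tarski satisfaction. *)
Definition tarski_clauses (C P ar M c r Sat : var) : bform :=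
  (∀ s t w a x y, term C s ⟶ term C t ⟶ is_eql s t w ⟶ assignment M a ⟶
     value c a s x ⟶ value c a t y ⟶
     (opair_in w a Sat ⟺ x ≡ y))
  ⊓ (∀ R ts w a i b, arguments C P ar R ts ⟶ is_rel R ts w ⟶ assignment M a ⟶
     opair_in R i r ⟶ values M ar c a R ts b ⟶
     (opair_in w a Sat ⟺ b ∈ i))
  ⊓ (∀ w a, is_bot w ⟶ assignment M a ⟶ (opair_in w a Sat ⟺ ⊥))
  ⊓ (∀ p w a, formula C P ar p ⟶ is_neg p w ⟶ assignment M a ⟶
     (opair_in w a Sat ⟺ ∼ opair_in p a Sat))
  ⊓ (∀ p q w a, formula C P ar p ⟶ formula C P ar q ⟶ assignment M a ⟶
     (is_and p q w ⟶
       (opair_in w a Sat ⟺ (opair_in p a Sat ⊓ opair_in q a Sat)))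
     ⊓ (is_or p q w ⟶
       (opair_in w a Sat ⟺ (opair_in p a Sat ⊔ opair_in q a Sat)))
     ⊓ (is_imp p q w ⟶
       (opair_in w a Sat ⟺ (opair_in p a Sat ⟶ opair_in q a Sat))))
  ⊓ (∀ n p w a, omega n ⟶ formula C P ar p ⟶ assignment M a ⟶
     (is_ex n p w ⟶
       (opair_in w a Sat ⟺
          (∃ m, m ∈ M ⊓ the_update M a n m (fun a' => opair_in p a' Sat))))
     ⊓ (is_all n p w ⟶
       (opair_in w a Sat ⟺
          (∀ m, m ∈ M ⟶ the_update M a n m (fun a' => opair_in p a' Sat))))).

(* 𝓜 ⊨ φ[a] *)
Definition tarski_sat (C P ar M c r phi a : var) : bform :=
  ∃ Sat, bang (tarski_clauses C P ar M c r Sat) ⊓ opair_in phi a Sat.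

(* Σ ⊨ φ *)
Definition tarski_consequence (C P ar Sigma phi : var) : bform :=
  ∀ M c r a, tarski_model C P ar M c r ⟶ assignment M a ⟶
    (∀ psi, psi ∈ Sigma ⟶ tarski_sat C P ar M c r psi a) ⟶
    tarski_sat C P ar M c r phi a.

(** ** T/F-semantics *)

(* rp, rn give the relations R⁺, R⁻, and ep, en are =⁺, =⁻. *)
Definition internal_tf_model (C P ar M c rp rn ep en : var) : bform :=
  domain M ⊓ cfun c C M ⊓ cfun_on rp P ⊓ cfun_on rn P
  ⊓ (∀ R n i, opair_in R n ar ⟶ (opair_in R i rp ⊔ opair_in R i rn) ⟶
       classical i ⊓ subcls (elts i) (power M n))
  ⊓ (classical ep ⊓ subcls (elts ep) (prod M M))
  ⊓ (classical en ⊓ subcls (elts en) (prod M M))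
  ⊓ (∀ a b, opair_in a b en ⟶ opair_in b a en)
  ⊓ (∀ a b, a ∈ M ⟶ b ∈ M ⟶ (opair_in a b ep ⟷ bang (a ≡ b))).

(* The classical relations T and F satisfy the recursion clauses of ⊨ᵀ and ⊨ᶠ. *)
Definition tf_clauses (C P ar M c rp rn ep en T F : var) : bform :=
  classical T ⊓ classical F
  ⊓ (∀ s t w a x y, term C s ⟶ term C t ⟶ is_eql s t w ⟶ assignment M a ⟶
     value c a s x ⟶ value c a t y ⟶
     (opair_in w a T ⟷ opair_in x y ep) ⊓ (opair_in w a F ⟷ opair_in x y en))
  ⊓ (∀ R ts w a i j b, arguments C P ar R ts ⟶ is_rel R ts w ⟶ assignment M a ⟶
     opair_in R i rp ⟶ opair_in R j rn ⟶ values M ar c a R ts b ⟶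
     (opair_in w a T ⟷ b ∈ i) ⊓ (opair_in w a F ⟷ b ∈ j))
  ⊓ (∀ w a, is_bot w ⟶ assignment M a ⟶
     cneg (opair_in w a T) ⊓ opair_in w a F)
  ⊓ (∀ p w a, formula C P ar p ⟶ is_neg p w ⟶ assignment M a ⟶
     (opair_in w a T ⟷ opair_in p a F) ⊓ (opair_in w a F ⟷ opair_in p a T))
  ⊓ (∀ p q w a, formula C P ar p ⟶ formula C P ar q ⟶ assignment M a ⟶
     (is_and p q w ⟶
       (opair_in w a T ⟷ (opair_in p a T ⊓ opair_in q a T))
       ⊓ (opair_in w a F ⟷ (opair_in p a F ⊔ opair_in q a F)))
     ⊓ (is_or p q w ⟶
       (opair_in w a T ⟷ (opair_in p a T ⊔ opair_in q a T))
       ⊓ (opair_in w a F ⟷ (opair_in p a F ⊓ opair_in q a F)))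
     ⊓ (is_imp p q w ⟶
       (opair_in w a T ⟷ (opair_in p a T ⟶ opair_in q a T))
       ⊓ (opair_in w a F ⟷ (opair_in p a T ⊓ opair_in q a F))))
  ⊓ (∀ n p w a, omega n ⟶ formula C P ar p ⟶ assignment M a ⟶
     (is_ex n p w ⟶
       (opair_in w a T ⟷
          (∃ m, m ∈ M ⊓ the_update M a n m (fun a' => opair_in p a' T)))
       ⊓ (opair_in w a F ⟷
          (∀ m, m ∈ M ⟶ the_update M a n m (fun a' => opair_in p a' F))))
     ⊓ (is_all n p w ⟶
       (opair_in w a T ⟷
          (∀ m, m ∈ M ⟶ the_update M a n m (fun a' => opair_in p a' T)))
       ⊓ (opair_in w a F ⟷
          (∃ m, m ∈ M ⊓ the_update M a n m (fun a' => opair_in p a' F))))).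

(* 𝓜 ⊨ᵀ φ[a] *)
Definition tf_true (C P ar M c rp rn ep en phi a : var) : bform :=
  ∃ T F, bang (tf_clauses C P ar M c rp rn ep en T F) ⊓ opair_in phi a T.

(* Σ ⊢ φ, as T/F-semantic consequence *)
Definition BS4_consequence (C P ar Sigma phi : var) : bform :=
  ∀ M c rp rn ep en a,
    internal_tf_model C P ar M c rp rn ep en ⟶ assignment M a ⟶
    (∀ psi, psi ∈ Sigma ⟶ tf_true C P ar M c rp rn ep en psi a) ⟶
    tf_true C P ar M c rp rn ep en phi a.

(* Main.v *)
(** A Tarski model and a T/F-model with the same satisfaction are interchangeable for
    consequence, so it suffices to turn each kind of model into the other.  A Tarski
    model with the relation r(R) yields the T/F-model on the same domain with
    R⁺ = r(R)^!, R⁻ the complement of r(R)^?, and =⁻ the falsity of identity.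
    Conversely, a T/F-model must be realized on a domain whose elements are unequal
    exactly as =⁻ prescribes: x is replaced by a set x' with x'^! = {(x,y) : y ∈ M} and
    x'^? = M×M minus {(y,x) : y =⁻ x}, which exists because ACLA lets Comprehension
    choose the two halves of a set independently.  Satisfaction relations need not be
    constructed: from Sat one reads off T as its positive part and
    F = {(φ,a) : (∼φ,a) ∈ Sat}, and back again; these are images of sets under
    definable maps, hence sets. *)

From Stdlib Require Import Classical List Lia.
Require Import Defs.

(** [BS4_proves] quantifies over T/F-models, so the argument runs in an arbitrary model [V] of BZFC,
    with classical logic outside it. Each formula of set theory is replaced by two ordinary
    propositions, the condition for its truth and the condition for its falsity, and sets are
    studied through the two independent relations [∈+] and [∈-]. The obstacle is that the schemas
    valid in [V] speak of formulas only: every set construction must exhibit one. Proof search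
    therefore runs in both directions, from formulas to conditions and from conditions to formulas.

    The set x' is explained by the falsity of equality: by Extensionality, x' ≠ y' holds iff some z
    is a member of one and a non-member of the other. Members of x' are pairs with first component
    x; non-members of y' inside M×M are pairs with second component y. Hence (x,y) is the only
    candidate for a witness in that direction, and it is made a non-member of y' exactly if x =⁻ y.
    Everything outside M×M is a non-member, so that both halves of x' are bounded by a set.

    Passing between models needs no induction on formulas: each recursion clause is transported
    separately. *)

Section Model.

(** * Worlds and the truth and falsity conditions of formulas *)

Variable V : tf_model.

Local Notation "x ∈+ y" := (mem_pos V x y) (at level 70, no associativity).
Local Notation "x ∈- y" := (mem_neg V x y) (at level 70, no associativity).

(* A world records the number of enclosing quantifiers and the values of the variables. *)
Definition world : Type := nat * (nat -> V).
Definition push (w : world) (a : V) : world := (S (fst w), scons a (snd w)).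
Definition denotes (w : world) (x : var) (a : V) : Prop :=
  x < fst w /\ snd w (ix (fst w) x) = a.
(* [tail w t]: the parameters of schema instances have the values [t]. *)
Definition tail (w : world) (t : nat -> V) : Prop := forall j, snd w (fst w + j) = t j.
(** The accessibility relation of going under binders. Levels do not shift, so whatever a variable
    denotes in [w] it still denotes in [w']. *)
Definition ext (w w' : world) : Prop :=
  (forall x a, denotes w x a -> denotes w' x a) /\ (forall t, tail w t -> tail w' t).

Lemma denotes_ext w w' x a : ext w w' -> denotes w x a -> denotes w' x a.
Proof. intros H; apply H. Qed.

Lemma tail_ext w w' t : ext w w' -> tail w t -> tail w' t.
Proof. intros H; apply H. Qed.

Lemma ext_trans w1 w2 w3 : ext w1 w2 -> ext w2 w3 -> ext w1 w3.
Proof. unfold ext; intros [H1 H2] [H3 H4]; split; auto. Qed.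

Lemma denotes_push w a : denotes (push w a) (fst w) a.
Proof.
  split; simpl; [lia|]. unfold ix. now replace (S (fst w) - 1 - fst w) with 0 by lia.
Qed.

Lemma ext_push w a : ext w (push w a).
Proof.
  (* Parameters start at index [fst w], which grows together with the environment, so [tail] is
     unchanged by conversion. *)
  split; [|exact (fun t H => H)].
  intros x b [H1 H2]; split; simpl; [lia|]. unfold ix in *.
  now replace (S (fst w) - 1 - x) with (S (fst w - 1 - x)) by lia.
Qed.

Definition truth (w : world) (A : bform) (P : Prop) : Prop :=
  tr V (snd w) (A (fst w)) <-> P.
Definition falsity (w : world) (A : bform) (P : Prop) : Prop :=
  fl V (snd w) (A (fst w)) <-> P.
(** Classical behaviour. Formulas of the form [bang A], [quest A] or [cneg A] have it whatever [A]
    is, so a single proposition describes both of their halves. *)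
Definition decided (w : world) (A : bform) (P : Prop) : Prop :=
  truth w A P /\ falsity w A (~ P).

Lemma truth_iff w A P Q : truth w A P -> (P <-> Q) -> truth w A Q.
Proof. unfold truth; tauto. Qed.

Lemma falsity_iff w A P Q : falsity w A P -> (P <-> Q) -> falsity w A Q.
Proof. unfold falsity; tauto. Qed.

Lemma decided_truth w A P : decided w A P -> truth w A P.
Proof. unfold decided; tauto. Qed.

Lemma decided_falsity w A P : decided w A P -> falsity w A (~ P).
Proof. unfold decided; tauto. Qed.

Lemma truth_mem w x y a b : denotes w x a -> denotes w y b -> truth w (x ∈ y) (a ∈+ b).
Proof. intros [_ <-] [_ <-]; apply iff_refl. Qed.

Lemma falsity_mem w x y a b : denotes w x a -> denotes w y b -> falsity w (x ∈ y) (a ∈- b).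
Proof. intros [_ <-] [_ <-]; apply iff_refl. Qed.

Lemma truth_eql w x y a b : denotes w x a -> denotes w y b -> truth w (x ≡ y) (a = b).
Proof. intros [_ <-] [_ <-]; apply iff_refl. Qed.

Lemma falsity_eql w x y a b :
  denotes w x a -> denotes w y b -> falsity w (x ≡ y) (eql_neg V a b).
Proof. intros [_ <-] [_ <-]; apply iff_refl. Qed.

Lemma decided_bot w : decided w ⊥ False.
Proof. split; cbv; tauto. Qed.

Lemma truth_neg w A P : falsity w A P -> truth w (∼ A) P.
Proof. exact (fun H => H). Qed.

Lemma falsity_neg w A P : truth w A P -> falsity w (∼ A) P.
Proof. exact (fun H => H). Qed.

Lemma truth_and w A B P Q : truth w A P -> truth w B Q -> truth w (A ⊓ B) (P /\ Q).
Proof. unfold truth; simpl; tauto. Qed.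

Lemma falsity_and w A B P Q : falsity w A P -> falsity w B Q -> falsity w (A ⊓ B) (P \/ Q).
Proof. unfold falsity; simpl; tauto. Qed.

Lemma truth_or w A B P Q : truth w A P -> truth w B Q -> truth w (A ⊔ B) (P \/ Q).
Proof. unfold truth; simpl; tauto. Qed.

Lemma falsity_or w A B P Q : falsity w A P -> falsity w B Q -> falsity w (A ⊔ B) (P /\ Q).
Proof. unfold falsity; simpl; tauto. Qed.

Lemma truth_imp w A B P Q : truth w A P -> truth w B Q -> truth w (A ⟶ B) (P -> Q).
Proof. unfold truth; simpl; tauto. Qed.

Lemma falsity_imp w A B P Q : truth w A P -> falsity w B Q -> falsity w (A ⟶ B) (P /\ Q).
Proof. unfold truth, falsity; simpl; tauto. Qed.

(** The hypothesis speaks of every extension of [w] and every variable denoting [a], although only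
    [push w a] is used: in this form proof search can treat the bound variable as opaque. *)
Lemma truth_all w (A : var -> bform) (P : V -> Prop) :
  (forall w' x a, ext w w' -> denotes w' x a -> truth w' (A x) (P a)) ->
  truth w (ball A) (forall a, P a).
Proof.
  intros H. unfold truth; simpl.
  split; intros K a; apply (H (push w a) (fst w) a (ext_push w a) (denotes_push w a)), K.
Qed.

Lemma falsity_all w (A : var -> bform) (P : V -> Prop) :
  (forall w' x a, ext w w' -> denotes w' x a -> falsity w' (A x) (P a)) ->
  falsity w (ball A) (exists a, P a).
Proof.
  intros H. unfold falsity; simpl.
  split; intros [a K]; exists a;
    apply (H (push w a) (fst w) a (ext_push w a) (denotes_push w a)), K.
Qed.

Lemma truth_ex w (A : var -> bform) (P : V -> Prop) :
  (forall w' x a, ext w w' -> denotes w' x a -> truth w' (A x) (P a)) ->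
  truth w (bex A) (exists a, P a).
Proof.
  intros H. unfold truth; simpl.
  split; intros [a K]; exists a;
    apply (H (push w a) (fst w) a (ext_push w a) (denotes_push w a)), K.
Qed.

Lemma falsity_ex w (A : var -> bform) (P : V -> Prop) :
  (forall w' x a, ext w w' -> denotes w' x a -> falsity w' (A x) (P a)) ->
  falsity w (bex A) (forall a, P a).
Proof.
  intros H. unfold falsity; simpl.
  split; intros K a; apply (H (push w a) (fst w) a (ext_push w a) (denotes_push w a)), K.
Qed.

Lemma truth_biff w A B P Q : truth w A P -> truth w B Q -> truth w (A ⟷ B) (P <-> Q).
Proof. unfold truth; simpl; tauto. Qed.

Lemma truth_bsimp w A B P P' Q Q' :
  truth w A P -> falsity w A P' -> truth w B Q -> falsity w B Q' ->
  truth w (A ⟹ B) ((P -> Q) /\ (Q' -> P')).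
Proof. unfold truth, falsity; simpl; tauto. Qed.

Lemma truth_bsiff w A B P P' Q Q' :
  truth w A P -> falsity w A P' -> truth w B Q -> falsity w B Q' ->
  truth w (A ⟺ B) ((P <-> Q) /\ (P' <-> Q')).
Proof. unfold truth, falsity; simpl; tauto. Qed.

(** The two contrapositive halves contribute the same two disjuncts once more. Inside Extensionality
    this condition becomes the meaning of [≠]. *)
Lemma falsity_bsiff w A B P P' Q Q' :
  truth w A P -> falsity w A P' -> truth w B Q -> falsity w B Q' ->
  falsity w (A ⟺ B) (P /\ Q' \/ Q /\ P').
Proof. unfold truth, falsity; simpl; tauto. Qed.

Lemma truth_bsiff_decided w A B P Q :
  decided w A P -> decided w B Q -> truth w (A ⟺ B) (P <-> Q).
Proof. unfold decided, truth, falsity; simpl; tauto. Qed.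

Lemma truth_cneg w A P : truth w A P -> truth w (cneg A) (~ P).
Proof. unfold truth; simpl; tauto. Qed.

Lemma decided_cneg w A P : truth w A P -> decided w (cneg A) (~ P).
Proof. unfold decided, truth, falsity; simpl. destruct (classic P); tauto. Qed.

Lemma decided_bang w A P : truth w A P -> decided w (bang A) P.
Proof. unfold decided, truth, falsity; simpl; tauto. Qed.

Lemma decided_quest w A P : falsity w A P -> decided w (quest A) (~ P).
Proof.
  unfold decided, truth, falsity; simpl. intros H; split; [tauto|].
  split; [tauto|]. intros K; apply NNPP; tauto.
Qed.

Lemma decided_and w A B P Q : decided w A P -> decided w B Q -> decided w (A ⊓ B) (P /\ Q).
Proof.
  intros [HA HA'] [HB HB']; split; [now apply truth_and|].
  eapply falsity_iff; [apply falsity_and; eassumption|tauto].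
Qed.

Lemma decided_or w A B P Q : decided w A P -> decided w B Q -> decided w (A ⊔ B) (P \/ Q).
Proof.
  intros [HA HA'] [HB HB']; split; [now apply truth_or|].
  eapply falsity_iff; [apply falsity_or; eassumption|tauto].
Qed.

Lemma decided_ex w (A : var -> bform) (P : V -> Prop) :
  (forall w' x a, ext w w' -> denotes w' x a -> decided w' (A x) (P a)) ->
  decided w (bex A) (exists a, P a).
Proof.
  intros H; split; [apply truth_ex; intros; now apply H|].
  eapply falsity_iff; [apply falsity_ex with (P := fun a => ~ P a); intros; now apply H|].
  firstorder.
Qed.

(** ** Class terms *)

Definition has_members (x : V) (P N : V -> Prop) : Prop :=
  forall y, (y ∈+ x <-> P y) /\ (y ∈- x <-> N y).
Definition is_class (x : V) (P : V -> Prop) : Prop :=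
  has_members x P (fun y => ~ P y).
Definition crisp (x : V) : Prop := forall y, y ∈+ x <-> ~ y ∈- x.

Lemma truth_is_set w x (A : cls) a (P N : V -> Prop) :
  denotes w x a ->
  (forall w' y b, ext w w' -> denotes w' y b -> truth w' (A y) (P b)) ->
  (forall w' y b, ext w w' -> denotes w' y b -> falsity w' (A y) (N b)) ->
  truth w (is_set x A) (has_members a P N).
Proof.
  intros Hx HP HN. apply truth_all; intros w' y b He Hy.
  apply truth_bsiff; eauto using truth_mem, falsity_mem, denotes_ext.
Qed.

Lemma truth_is_class w x (A : cls) a (P : V -> Prop) :
  denotes w x a ->
  (forall w' y b, ext w w' -> denotes w' y b -> decided w' (A y) (P b)) ->
  truth w (is_set x A) (is_class a P).
Proof. intros Hx H. apply truth_is_set; trivial; intros; now apply H. Qed.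

Lemma truth_the w (A : cls) (psi : var -> bform) (S F : V -> Prop) :
  (forall w' s a, ext w w' -> denotes w' s a -> truth w' (is_set s A) (S a)) ->
  (forall w' s a, ext w w' -> denotes w' s a -> truth w' (psi s) (F a)) ->
  truth w (the A psi) (exists s, S s /\ F s).
Proof.
  intros HS HF. apply truth_ex with (P := fun s => S s /\ F s); intros.
  apply truth_and; auto. apply decided_truth, decided_bang; auto.
Qed.

Lemma falsity_the w (A : cls) (psi : var -> bform) (S F : V -> Prop) :
  (forall w' s a, ext w w' -> denotes w' s a -> truth w' (is_set s A) (S a)) ->
  (forall w' s a, ext w w' -> denotes w' s a -> falsity w' (psi s) (F a)) ->
  falsity w (the A psi) (forall s, S s -> F s).
Proof.
  intros HS HF. eapply falsity_iff.
  - apply falsity_ex with (P := fun s => ~ S s \/ F s); intros.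
    apply falsity_and; auto. apply decided_falsity, decided_bang; auto.
  - split; intros H s; [specialize (H s); tauto|].
    destruct (classic (S s)); auto.
Qed.

Lemma decided_the w (A : cls) (psi : var -> bform) (S F : V -> Prop) :
  (forall w' s a, ext w w' -> denotes w' s a -> truth w' (is_set s A) (S a)) ->
  (forall w' s a, ext w w' -> denotes w' s a -> decided w' (psi s) (F a)) ->
  decided w (the A psi) (exists s, S s /\ F s).
Proof.
  intros HS HF; split; [apply truth_the; trivial; intros; now apply HF|].
  eapply falsity_iff; [apply falsity_the with (S := S) (F := fun s => ~ F s); trivial;
                       intros; now apply HF|].
  firstorder.
Qed.

Lemma truth_subcls w (A B : cls) (P P' Q Q' : V -> Prop) :
  (forall w' y b, ext w w' -> denotes w' y b -> truth w' (A y) (P b)) ->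
  (forall w' y b, ext w w' -> denotes w' y b -> falsity w' (A y) (P' b)) ->
  (forall w' y b, ext w w' -> denotes w' y b -> truth w' (B y) (Q b)) ->
  (forall w' y b, ext w w' -> denotes w' y b -> falsity w' (B y) (Q' b)) ->
  truth w (subcls A B) (forall y, (P y -> Q y) /\ (Q' y -> P' y)).
Proof. intros. apply truth_all; intros. apply truth_bsimp; auto. Qed.

Lemma falsity_subcls w (A B : cls) (P P' Q Q' : V -> Prop) :
  (forall w' y b, ext w w' -> denotes w' y b -> truth w' (A y) (P b)) ->
  (forall w' y b, ext w w' -> denotes w' y b -> falsity w' (A y) (P' b)) ->
  (forall w' y b, ext w w' -> denotes w' y b -> truth w' (B y) (Q b)) ->
  (forall w' y b, ext w w' -> denotes w' y b -> falsity w' (B y) (Q' b)) ->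
  falsity w (subcls A B) (exists y, P y /\ Q' y).
Proof.
  intros. apply falsity_all; intros.
  assert (HP : truth w' (A x) (P a)) by auto. assert (HP' : falsity w' (A x) (P' a)) by auto.
  assert (HQ : truth w' (B x) (Q a)) by auto. assert (HQ' : falsity w' (B x) (Q' a)) by auto.
  unfold truth, falsity in *; simpl; tauto.
Qed.

(* Computes truth conditions by syntax-directed search. Constants are opaque so that a notion with
   its own lemma is recognized by name and not unfolded. The costs make the classical readings
   [truth_is_class] and [truth_bsiff_decided] win over the general two-sided ones, and make the
   detour through [decided] a last resort. *)
Create HintDb sem discriminated.
Hint Constants Opaque : sem.
Hint Variables Opaque : sem.
Hint Transparent cls var bform : sem.
Hint Resolve truth_mem falsity_mem truth_eql falsity_eql decided_bot truth_neg falsity_neg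
  truth_and falsity_and truth_or falsity_or truth_imp falsity_imp truth_all falsity_all
  truth_ex falsity_ex truth_biff falsity_bsiff truth_cneg decided_cneg decided_bang decided_quest decided_and
  decided_or decided_ex truth_the falsity_the decided_the truth_subcls falsity_subcls : sem.
Hint Resolve truth_is_class truth_bsiff_decided | 0 : sem.
Hint Resolve truth_is_set truth_bsiff | 20 : sem.
Hint Resolve denotes_ext tail_ext | 5 : sem.
Hint Resolve decided_truth decided_falsity | 30 : sem.

Ltac sem := typeclasses eauto with sem nocore.

(** * Meaning of pairs and functions in the model *)

Definition empty_eq (z : V) : Prop := is_class z (fun _ => False).
Definition sing_eq (u z : V) : Prop := is_class z (fun t => t = u).
Definition upair_eq (u v z : V) : Prop := is_class z (fun t => t = u \/ t = v).
Definition kpair_eq (u v z : V) : Prop :=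
  is_class z (fun t => sing_eq u t \/ upair_eq u v t).

Lemma truth_empty w z c : denotes w z c -> truth w (is_set z empty) (empty_eq c).
Proof. intros. apply truth_is_class; trivial. intros. apply decided_bot. Qed.

Lemma truth_sing w u z a c :
  denotes w u a -> denotes w z c -> truth w (is_set z (sing u)) (sing_eq a c).
Proof. intros. apply truth_is_class; trivial. unfold sing. sem. Qed.

Lemma truth_upair w u v z a b c :
  denotes w u a -> denotes w v b -> denotes w z c ->
  truth w (is_set z (upair u v)) (upair_eq a b c).
Proof. intros. apply truth_is_class; trivial. unfold upair. sem. Qed.
Hint Resolve truth_empty truth_sing truth_upair : sem.

Lemma truth_kpair w u v z a b c :
  denotes w u a -> denotes w v b -> denotes w z c ->
  truth w (is_set z (kpair u v)) (kpair_eq a b c).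
Proof. intros. apply truth_is_class; trivial. unfold kpair. sem. Qed.
Hint Resolve truth_kpair : sem.

Lemma truth_subset w x y a b :
  denotes w x a -> denotes w y b ->
  truth w (subset x y) (forall z, (z ∈+ a -> z ∈+ b) /\ (z ∈- b -> z ∈- a)).
Proof. intros. unfold subset, elts. sem. Qed.

Lemma truth_classical w x a : denotes w x a -> truth w (classical x) (crisp a).
Proof. intros. unfold classical, bang_part, quest_part, crisp. sem. Qed.
Hint Resolve truth_subset truth_classical : sem.

Definition tag (A B : V -> Prop) (z : V) : Prop :=
  (exists x, (exists e, empty_eq e /\ kpair_eq x e z) /\ A x) \/
  (exists y, (exists e, empty_eq e /\ exists o, sing_eq e o /\ kpair_eq y o z) /\ B y).

Lemma decided_tag w z (A B : cls) c (P Q : V -> Prop) :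
  denotes w z c ->
  (forall w' x a, ext w w' -> denotes w' x a -> decided w' (A x) (P a)) ->
  (forall w' y b, ext w w' -> denotes w' y b -> decided w' (B y) (Q b)) ->
  decided w (tagged_union A B z) (tag P Q c).
Proof. intros. unfold tagged_union, tag. sem. Qed.
Hint Resolve decided_tag : sem.

Definition opair_eq (a b p : V) : Prop :=
  (forall z, z ∈+ p <-> tag (fun x => x ∈+ a) (fun y => y ∈+ b) z) /\
  (forall z, ~ z ∈- p <-> tag (fun x => ~ x ∈- a) (fun y => ~ y ∈- b) z).

Lemma truth_is_opair w p a b c x y :
  denotes w p c -> denotes w a x -> denotes w b y ->
  truth w (is_opair p a b) (opair_eq x y c).
Proof. intros. unfold is_opair, opair_eq, bang_part, quest_part. sem. Qed.
Hint Resolve truth_is_opair : sem.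

Definition pair_in (a b R : V) : Prop := exists p, opair_eq a b p /\ p ∈+ R.
Definition pair_notin (a b R : V) : Prop := forall p, opair_eq a b p -> p ∈- R.

Lemma truth_opair_in w a b R x y r :
  denotes w a x -> denotes w b y -> denotes w R r ->
  truth w (opair_in a b R) (pair_in x y r).
Proof. intros. unfold opair_in, pair_in. sem. Qed.

Lemma falsity_opair_in w a b R x y r :
  denotes w a x -> denotes w b y -> denotes w R r ->
  falsity w (opair_in a b R) (pair_notin x y r).
Proof.
  intros. eapply falsity_iff with (P := forall p, ~ opair_eq x y p \/ p ∈- r);
    [unfold opair_in; sem|].
  unfold pair_notin; split; intros K p; specialize (K p); tauto.
Qed.
Hint Resolve truth_opair_in falsity_opair_in : sem.

(** The usable form of [cfun f A B], proved equivalent in [truth_cfun]. As [f] is crisp, the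
    contrapositive half of f ⊆ A×B shrinks to [~ b ∈- B]; and [A], being the domain of a crisp set,
    is itself crisp. *)
Definition maps (f A B : V) : Prop :=
  crisp f /\
  (forall z, z ∈+ f -> exists a b, opair_eq a b z /\ a ∈+ A /\ b ∈+ B /\ ~ b ∈- B) /\
  crisp A /\
  (forall x, x ∈+ A -> exists y, pair_in x y f) /\
  (forall x y z, pair_in x y f -> pair_in x z f -> y = z).

Lemma truth_cfun_raw w f A B a b g :
  denotes w f g -> denotes w A a -> denotes w B b ->
  truth w (cfun f A B)
    (crisp g /\
     (forall z, (z ∈+ g -> exists x y, opair_eq x y z /\ x ∈+ a /\ y ∈+ b) /\
        ((forall x y, ~ opair_eq x y z \/ x ∈- a \/ y ∈- b) -> z ∈- g)) /\
     has_members a (fun x => exists y, pair_in x y g) (fun x => forall y, pair_notin x y g) /\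
     (forall x y z, pair_in x y g /\ pair_in x z g -> y = z)).
Proof. intros. unfold cfun, elts, prod, dom. sem. Qed.

(** * Schema instances and their parameters *)

Lemma tr_fl_ext (A : form) : forall e e' : nat -> V, (forall i, e i = e' i) ->
  (tr V e A <-> tr V e' A) /\ (fl V e A <-> fl V e' A).
Proof.
  assert (L : forall (e e' : nat -> V) a, (forall i, e i = e' i) ->
    forall i, scons a e i = scons a e' i) by (intros e e' a H [|i]; simpl; auto).
  induction A; intros e e' H; simpl;
    try (rewrite <- !H; tauto); try tauto;
    try (specialize (IHA _ _ H); tauto);
    try (specialize (IHA1 _ _ H); specialize (IHA2 _ _ H); tauto);
    (assert (K := fun a => IHA _ _ (L _ _ a H)); clear - K; split; firstorder).
Qed.

Lemma tr_fl_rename (A : form) : forall (r : nat -> nat) (e : nat -> V),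
  (tr V e (rename r A) <-> tr V (fun i => e (r i)) A) /\
  (fl V e (rename r A) <-> fl V (fun i => e (r i)) A).
Proof.
  assert (B : forall (A : form) (r : nat -> nat) (e : nat -> V) a,
    (forall (r : nat -> nat) (e : nat -> V),
      (tr V e (rename r A) <-> tr V (fun i => e (r i)) A) /\
      (fl V e (rename r A) <-> fl V (fun i => e (r i)) A)) ->
    (tr V (scons a e) (rename (scons 0 (fun n => S (r n))) A) <->
       tr V (scons a (fun i => e (r i))) A) /\
    (fl V (scons a e) (rename (scons 0 (fun n => S (r n))) A) <->
       fl V (scons a (fun i => e (r i))) A)).
  { intros A' r e a H.
    destruct (H (scons 0 (fun n => S (r n))) (scons a e)) as [H1 H2].
    destruct (tr_fl_ext A' (fun i => scons a e (scons 0 (fun n => S (r n)) i))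
                (scons a (fun i => e (r i)))) as [H3 H4]; [now intros [|i]|].
    tauto. }
  induction A; intros r e; simpl; try tauto;
    try (specialize (IHA r e); tauto);
    try (specialize (IHA1 r e); specialize (IHA2 r e); tauto);
    (assert (K := fun a => B _ r e a IHA); clear - K; split; firstorder).
Qed.

Definition args_env (args : list V) (t : nat -> V) : nat -> V :=
  fold_right (fun a e => scons a e) t args.

Lemma inst_env w args vals t : tail w t -> Forall2 (denotes w) args vals -> forall i,
  snd w (match nth_error args i with
         | Some x => ix (fst w) x
         | None => fst w + (i - length args)
         end) = args_env vals t i.
Proof.
  intros Ht H. induction H as [|x a args vals [_ Hx] _ IH]; intros i; simpl.
  - destruct i; simpl; rewrite Ht; reflexivity.
  - destruct i as [|i]; simpl; [exact Hx|apply IH].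
Qed.

Lemma truth_inst w phi args vals t : tail w t -> Forall2 (denotes w) args vals ->
  truth w (inst phi args) (tr V (args_env vals t) phi).
Proof.
  intros Ht H. unfold truth, inst.
  rewrite (proj1 (tr_fl_rename _ _ _)). apply tr_fl_ext, inst_env; assumption.
Qed.

Lemma falsity_inst w phi args vals t : tail w t -> Forall2 (denotes w) args vals ->
  falsity w (inst phi args) (fl V (args_env vals t) phi).
Proof.
  intros Ht H. unfold falsity, inst.
  rewrite (proj2 (tr_fl_rename _ _ _)). apply tr_fl_ext, inst_env; assumption.
Qed.
Hint Resolve truth_inst falsity_inst Forall2_cons Forall2_nil : sem.

(** * The axioms as statements about the model *)

Hypothesis V_theory : forall A, BZFC A -> valid V A.

(** An axiom is evaluated at depth 0, where the whole environment consists of parameters; validity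
    lets these be any [t]. *)
Lemma axiom_truth A (t : nat -> V) P :
  BZFC (close A) -> (forall w, tail w t -> truth w A P) -> P.
Proof.
  intros HA H. apply (H (0, t) (fun j => eq_refl)), (V_theory _ HA).
Qed.

Lemma closed_axiom_truth A P : BZFC (close A) -> (forall w, truth w A P) -> P.
Proof.
  destruct (carrier_inhabited V) as [o]. intros HA H.
  apply axiom_truth with (A := A) (t := fun _ => o); auto.
Qed.

Lemma extensionality x y :
  (x = y <-> forall z, (z ∈+ x <-> z ∈+ y) /\ (z ∈- x <-> z ∈- y)) /\
  (eql_neg V x y <-> exists z, z ∈+ x /\ z ∈- y \/ z ∈+ y /\ z ∈- x).
Proof.
  revert x y. apply closed_axiom_truth with (A := ax_extensionality);
    [apply BZFC_PZFC, PZFC_extensionality|].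
  intros. unfold ax_extensionality. sem.
Qed.

Lemma comprehension w A (P N : V -> Prop) u :
  (forall w' x a, ext w w' -> denotes w' x a -> truth w' (A x) (P a)) ->
  (forall w' x a, ext w w' -> denotes w' x a -> falsity w' (A x) (N a)) ->
  exists x, has_members x (fun y => y ∈+ u /\ P y) (fun y => y ∈- u \/ N y).
Proof.
  intros HP HN.
  (* The body of [A] under one new binder: index 0 is the element, and index j+1 is index j of [w],
     so the environment of [w] serves as the parameters. *)
  set (phi := A (fst w) (S (fst w))).
  assert (K : forall u, exists x, forall y,
    (y ∈+ x <-> y ∈+ u /\ tr V (args_env (y :: nil) (snd w)) phi) /\
    (y ∈- x <-> y ∈- u \/ fl V (args_env (y :: nil) (snd w)) phi)).
  { apply axiom_truth with (A := ax_comprehension phi) (t := snd w);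
      [apply BZFC_PZFC, PZFC_comprehension|].
    intros. unfold ax_comprehension. sem. }
  destruct (K u) as [x Hx]; exists x; intros y.
  specialize (HP (push w y) (fst w) y (ext_push w y) (denotes_push w y)).
  specialize (HN (push w y) (fst w) y (ext_push w y) (denotes_push w y)).
  unfold truth, falsity in HP, HN. specialize (Hx y). simpl in *. fold phi in HP, HN.
  tauto.
Qed.

Lemma replacement w (A : var -> var -> bform) (R : V -> V -> Prop) u :
  (forall w' x y a b, ext w w' -> denotes w' x a -> denotes w' y b ->
     truth w' (A x y) (R a b)) ->
  (forall a, exists b, R a b /\ forall c, R a c -> b = c) ->
  exists v, has_members v (fun z => exists a, a ∈+ u /\ R a z)
                          (fun z => forall a, a ∈- u \/ ~ R a z).
Proof.
  intros HR Htot.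
  (* Replacement demands a classical formula, hence [bang]. The first displayed argument is index 0,
     the innermost binder, so it gets the higher level. *)
  set (phi := bang (A (S (fst w)) (fst w)) (S (S (fst w)))).
  assert (E : forall a b,
    (tr V (args_env (a :: b :: nil) (snd w)) phi <-> R a b) /\
    (fl V (args_env (a :: b :: nil) (snd w)) phi <-> ~ R a b)).
  { intros a b. apply (decided_bang (push (push w b) a)). apply HR.
    - intros; split; intros; apply ext_push, ext_push; assumption.
    - apply denotes_push.
    - apply (ext_push (push w b) a), denotes_push. }
  assert (K : ((forall a b,
      tr V (args_env (a :: b :: nil) (snd w)) phi <->
      ~ fl V (args_env (a :: b :: nil) (snd w)) phi) /\
      (forall a, exists b, tr V (args_env (a :: b :: nil) (snd w)) phi /\
        forall c, tr V (args_env (a :: c :: nil) (snd w)) phi -> b = c)) ->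
    forall u, exists v, forall z,
      (z ∈+ v <-> exists a, a ∈+ u /\ tr V (args_env (a :: z :: nil) (snd w)) phi) /\
      (z ∈- v <-> forall a, a ∈- u \/ fl V (args_env (a :: z :: nil) (snd w)) phi)).
  { apply axiom_truth with (A := ax_replacement phi) (t := snd w);
      [apply BZFC_PZFC, PZFC_replacement|].
    intros. unfold ax_replacement, circ. sem. }
  destruct K with (u := u) as [v Hv].
  - split.
    + intros a b. destruct (E a b); destruct (classic (R a b)); tauto.
    + intros a. destruct (Htot a) as [b [Hb Hb']]. exists b.
      split; [now apply E|]. intros c Hc; now apply Hb', E.
  - exists v. intros z. destruct (Hv z) as [H1 H2]. split.
    + rewrite H1. split; intros [a Ha]; exists a; destruct (E a z); tauto.
    + rewrite H2. split; intros L a; specialize (L a); destruct (E a z); tauto.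
Qed.

Lemma superset x :
  exists c, (forall z, (z ∈+ x -> z ∈+ c) /\ (z ∈- c -> z ∈- x)) /\ crisp c.
Proof.
  revert x. apply closed_axiom_truth with (A := ax_classical_superset);
    [apply BZFC_PZFC, PZFC_classical_superset|].
  intros. unfold ax_classical_superset, circ, crisp. sem.
Qed.

Lemma pairing u v : exists z, upair_eq u v z.
Proof.
  revert u v. apply closed_axiom_truth with (A := ax_pairing);
    [apply BZFC_PZFC, PZFC_pairing|].
  intros. unfold ax_pairing. sem.
Qed.

Lemma power_set u : exists v, forall x,
  (x ∈+ v <-> forall z, (z ∈+ x -> z ∈+ u) /\ (z ∈- u -> z ∈- x)) /\
  (x ∈- v <-> ~ forall z, (z ∈+ x -> z ∈+ u) /\ (z ∈- u -> z ∈- x)).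
Proof.
  revert u. apply closed_axiom_truth with (A := ax_power_set);
    [apply BZFC_PZFC, PZFC_power_set|].
  intros. unfold ax_power_set. sem.
Qed.

Lemma union u : exists x, forall y,
  (y ∈+ x <-> exists z, y ∈+ z /\ z ∈+ u) /\ (y ∈- x <-> forall z, y ∈- z \/ z ∈- u).
Proof.
  revert u. apply closed_axiom_truth with (A := ax_union);
    [apply BZFC_PZFC, PZFC_union|].
  intros. unfold ax_union. sem.
Qed.

(** A counterexample to the inclusion of the ! part in the ? part is a glut; one to the converse
    inclusion is a gap. *)
Lemma glut_and_gap : (exists x z, z ∈+ x /\ z ∈- x) /\ (exists x z, ~ z ∈+ x /\ ~ z ∈- x).
Proof.
  assert (K : (exists x z, z ∈+ x /\ ~ ~ z ∈- x) /\ (exists x z, ~ z ∈- x /\ ~ z ∈+ x)).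
  { apply closed_axiom_truth with (A := ax_ACLA); [apply BZFC_ACLA|].
    intros. unfold ax_ACLA, bang_part, quest_part. sem. }
  destruct K as [[x [z K]] [x' [z' K']]].
  split; [exists x, z; split; [|apply NNPP]|exists x', z']; tauto.
Qed.

(** * Formulas found from their truth conditions *)

Lemma truth_notin w x y a b : denotes w x a -> denotes w y b -> truth w (∼ (x ∈ y)) (a ∈- b).
Proof. apply falsity_mem. Qed.

Lemma truth_neq w x y a b :
  denotes w x a -> denotes w y b -> truth w (∼ (x ≡ y)) (eql_neg V a b).
Proof. apply falsity_eql. Qed.

Lemma truth_class w x (A : cls) a (P : V -> Prop) :
  denotes w x a ->
  (forall w' y b, ext w w' -> denotes w' y b -> truth w' (A y) (P b)) ->
  truth w (is_set x (fun y => bang (A y))) (is_class a P).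
Proof. intros. apply truth_is_class; trivial. intros. apply decided_bang. auto. Qed.

(** The negative half is described by the truth of a second formula [B], not by the falsity of [A].
    Thus every search for a formula deals with truth conditions only. *)
Lemma truth_has_members w x (A B : cls) a (P N : V -> Prop) :
  denotes w x a ->
  (forall w' y b, ext w w' -> denotes w' y b -> truth w' (A y) (P b)) ->
  (forall w' y b, ext w w' -> denotes w' y b -> truth w' (B y) (N b)) ->
  truth w (∀ y, (y ∈ x ⟷ A y) ⊓ (∼ (y ∈ x) ⟷ B y)) (has_members a P N).
Proof.
  intros. apply truth_all. intros. apply truth_and; apply truth_biff; auto;
    [apply truth_mem|apply truth_notin]; eauto using denotes_ext.
Qed.

(* Unlike [sem], which computes the truth condition of a given formula, [define] runs
   the same lemmas backwards to find a formula with a given truth condition. *)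
Create HintDb define discriminated.
Hint Constants Opaque : define.
Hint Variables Opaque : define.
Hint Transparent cls var bform : define.
Hint Resolve truth_biff truth_cneg | 0 : define.
Hint Resolve truth_mem truth_notin truth_eql truth_neq
  truth_and truth_or truth_imp truth_all truth_ex truth_class truth_has_members truth_empty
  truth_sing truth_upair truth_kpair truth_is_opair truth_opair_in truth_classical | 1 : define.
Hint Resolve denotes_ext | 5 : define.
Hint Resolve denotes_push ext_push : define.
Ltac define := typeclasses eauto with define nocore.

(** * Sets with prescribed members and non-members *)

Lemma eq_members x y P N : has_members x P N -> has_members y P N -> x = y.
Proof.
  intros Hx Hy. apply extensionality. intros z. destruct (Hx z), (Hy z); tauto.
Qed.

Lemma eq_classes x y P : is_class x P -> is_class y P -> x = y.
Proof. apply eq_members. Qed.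

Lemma is_class_iff x P Q : (forall z, P z <-> Q z) -> is_class x P -> is_class x Q.
Proof. intros H Hx z. destruct (Hx z). specialize (H z). tauto. Qed.

(** The contrapositive half of x ⊆ C puts the ? part of [x] into [c] as well, so [c] bounds
    everything that is not plainly outside [x]. *)
Lemma crisp_superset x : exists c, crisp c /\ forall z, z ∈+ x \/ ~ z ∈- x -> z ∈+ c.
Proof.
  destruct (superset x) as [c [H Hc]]. exists c; split; [exact Hc|].
  intros z. destruct (H z). specialize (Hc z). tauto.
Qed.

(* Conjoining [A] with a gap or disjoining it with a glut turns any pair of
   definable predicates into the truth and the falsity of one formula. *)
Lemma mk_set w A B (P Q : V -> Prop) u :
  (forall w' x a, ext w w' -> denotes w' x a -> truth w' (A x) (P a)) ->
  (forall w' x a, ext w w' -> denotes w' x a -> truth w' (B x) (Q a)) ->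
  (forall z, P z \/ ~ Q z -> z ∈+ u) ->
  exists x, has_members x P Q.
Proof.
  intros HP HQ Hu.
  destruct glut_and_gap as [[g [g' [Hg Hg']]] [n [n' [Hn Hn']]]].
  (* Intersecting with the classical [c] changes neither half: a point outside [c] fails [P] and
     satisfies [Q]. *)
  destruct (crisp_superset u) as [c [Hc Huc]].
  set (w4 := push (push (push (push w g) g') n) n').
  assert (E : ext w w4).
  { eapply ext_trans; [|apply ext_push]. do 2 (eapply ext_trans; [|apply ext_push]). apply ext_push. }
  assert (D1 : denotes w4 (fst w) g) by (do 3 apply ext_push; apply denotes_push).
  assert (D2 : denotes w4 (fst (push w g)) g') by (do 2 apply ext_push; apply denotes_push).
  assert (D3 : denotes w4 (fst (push (push w g) g')) n) by (apply ext_push; apply denotes_push).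
  assert (D4 : denotes w4 (fst (push (push (push w g) g') n)) n') by (apply denotes_push).
  clearbody w4.
  set (vg := fst w) in *. set (vg' := fst (push w g)) in *.
  set (vn := fst (push (push w g) g')) in *.
  set (vn' := fst (push (push (push w g) g') n)) in *.
  (* If [P] holds, the first disjunct is true, and it is also false exactly if [Q] holds, by the
     glut. If [P] fails, the first disjunct is just false, and the second is the gap if [Q] fails
     and false if [Q] holds. *)
  destruct (comprehension w4 (fun x =>
    (bang (A x) ⊓ (cneg (B x) ⊔ vg' ∈ vg)) ⊔
    (cneg (bang (A x)) ⊓ cneg (B x) ⊓ vn' ∈ vn)) P Q c) as [x Hx].
  - intros w' x a E' Hx.
    assert (HA : truth w' (A x) (P a)) by (apply HP; eauto using ext_trans).
    assert (HB : truth w' (B x) (Q a)) by (apply HQ; eauto using ext_trans).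
    eapply truth_iff; [sem|]. tauto.
  - intros w' x a E' Hx.
    assert (HA : truth w' (A x) (P a)) by (apply HP; eauto using ext_trans).
    assert (HB : truth w' (B x) (Q a)) by (apply HQ; eauto using ext_trans).
    eapply falsity_iff; [sem|]. tauto.
  - exists x. intros y. destruct (Hx y) as [H1 H2].
    specialize (Hc y). specialize (Hu y). specialize (Huc y). tauto.
Qed.

Lemma mk_class w A (P : V -> Prop) u :
  (forall w' x a, ext w w' -> denotes w' x a -> truth w' (A x) (P a)) ->
  (forall z, P z -> z ∈+ u) ->
  exists x, is_class x P.
Proof.
  intros HP Hu.
  apply (mk_set w A (fun x => cneg (A x)) P (fun x => ~ P x) u); trivial.
  - intros. apply truth_cneg; auto.
  - intros z H. apply Hu; tauto.
Qed.

(* Replacement asks for a total functional relation: [R] is made total by the identity. *)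
Lemma image w A (R : V -> V -> Prop) u :
  (forall w' x y a b, ext w w' -> denotes w' x a -> denotes w' y b ->
     truth w' (A x y) (R a b)) ->
  (forall a b c, a ∈+ u -> R a b -> R a c -> b = c) ->
  exists v, is_class v (fun z => exists a, a ∈+ u /\ R a z).
Proof.
  intros HR Hfun.
  set (wu := push w u).
  assert (E : ext w wu) by apply ext_push.
  assert (Du : denotes wu (fst w) u) by apply denotes_push.
  assert (HR' : forall w' x y a b, ext wu w' -> denotes w' x a -> denotes w' y b ->
     truth w' (A x y) (R a b)).
  { intros w' x y a b E' Hx Hy. apply HR; eauto using ext_trans. }
  clearbody wu. set (xu := fst w) in *.
  destruct (crisp_superset u) as [c [Hc Huc]].
  destruct (replacement wu
    (fun x y => (x ∈ xu ⊓ A x y) ⊔ (cneg (∃ z, x ∈ xu ⊓ A x z) ⊓ x ≡ y))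
    (fun a b => (a ∈+ u /\ R a b) \/ (~ (exists d, a ∈+ u /\ R a d)) /\ a = b) c) as [v Hv].
  - intros w' x y a b E' Hx Hy.
    assert (truth w' (A x y) (R a b)) by auto.
    assert (forall w'' z d, ext w' w'' -> denotes w'' z d -> truth w'' (A x z) (R a d)).
    eauto using ext_trans, denotes_ext.
    sem.
  - intros a. destruct (classic (exists d, a ∈+ u /\ R a d)) as [[d [Hd Hd']]|Hn].
    + exists d. split; [tauto|]. intros c' [[_ Hc']|[Hc' _]]; [eauto|]. now elim Hc'; exists d.
    + exists a. split; [tauto|]. intros c' [Hc'|[_ Hc']]; [|exact Hc']. elim Hn; now exists c'.
  (* Replacement over [c] also collects points that were mapped to themselves; only values taken on
     positive members of [u] are kept. *)
  - apply (mk_class wu (fun y => ∃ x, x ∈ xu ⊓ A x y)) with (u := v).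
    + intros w' y b E' Hy.
      assert (forall w'' x d, ext w' w'' -> denotes w'' x d -> truth w'' (A x y) (R d b)).
      eauto using ext_trans, denotes_ext.
      sem.
    + intros z [a [Ha Haz]]. apply Hv. exists a. split; [apply Huc|]; tauto.
Qed.

(** A base world without named variables, on which constructions push their parameters; [x] merely
    fills the environment. *)
Definition world0 (x : V) : world := (0, fun _ => x).

(** * Singletons, Kuratowski pairs and bounds *)

Lemma sing_exists a : exists x, sing_eq a x.
Proof.
  destruct (pairing a a) as [p Hp]. exists p. revert Hp; apply is_class_iff. tauto.
Qed.

Lemma sing_inj a b t : sing_eq a t -> sing_eq b t -> a = b.
Proof. intros Ha Hb. apply Hb, Ha; reflexivity. Qed.

Lemma sing_upair a b c t : sing_eq a t -> upair_eq b c t -> a = b /\ a = c.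
Proof. intros Ha Hb; split; symmetry; apply Ha, Hb; auto. Qed.

Lemma upair_inj a b c d t :
  upair_eq a b t -> upair_eq c d t -> a = c /\ b = d \/ a = d /\ b = c.
Proof.
  intros H K.
  assert (Ha : a = c \/ a = d) by (apply K, H; auto).
  assert (Hb : b = c \/ b = d) by (apply K, H; auto).
  assert (Hc : c = a \/ c = b) by (apply H, K; auto).
  assert (Hd : d = a \/ d = b) by (apply H, K; auto).
  intuition congruence.
Qed.

Lemma kpair_exists a b : exists z, kpair_eq a b z.
Proof.
  destruct (sing_exists a) as [s Hs], (pairing a b) as [t Ht], (pairing s t) as [z Hz].
  exists z. revert Hz. apply is_class_iff. intros y. split.
  - intros [->| ->]; auto.
  - intros [H|H]; [left|right]; eapply eq_classes; eassumption.
Qed.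

Lemma kpair_unique a b y z : kpair_eq a b y -> kpair_eq a b z -> y = z.
Proof. apply eq_classes. Qed.

Lemma kpair_inj a b c d z : kpair_eq a b z -> kpair_eq c d z -> a = c /\ b = d.
Proof.
  intros H K.
  assert (E : forall t, sing_eq a t \/ upair_eq a b t <-> sing_eq c t \/ upair_eq c d t).
  { intros t. destruct (H t), (K t). tauto. }
  assert (Hac : a = c).
  { destruct (sing_exists a) as [s Hs]. destruct (proj1 (E s) (or_introl Hs)) as [J|J].
    - eapply sing_inj; eassumption.
    - now destruct (sing_upair _ _ _ _ Hs J). }
  split; [exact Hac|]. subst c.
  destruct (pairing a b) as [t Ht], (pairing a d) as [t' Ht'].
  destruct (proj1 (E t) (or_intror Ht)) as [J|J].
  - destruct (sing_upair _ _ _ _ J Ht). subst b.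
    destruct (proj2 (E t') (or_intror Ht')) as [J'|J'].
    + now destruct (sing_upair _ _ _ _ J' Ht').
    + destruct (upair_inj _ _ _ _ _ J' Ht') as [[_ ?]|[? ?]]; congruence.
  - destruct (upair_inj _ _ _ _ _ J Ht) as [[_ ?]|[? ?]]; congruence.
Qed.

Lemma empty_exists : exists z, empty_eq z.
Proof.
  destruct (carrier_inhabited V) as [o].
  eapply (mk_class (world0 o) (fun x => ⊥)) with (u := o).
  - intros. apply decided_bot.
  - tauto.
Qed.

(** An upper bound is enough wherever a set is wanted, since [mk_set] and [mk_class] carve the exact
    set out of it. *)
Lemma union_bound u v : exists x, forall z, z ∈+ u \/ z ∈+ v -> z ∈+ x.
Proof.
  destruct (pairing u v) as [p Hp], (union p) as [x Hx]. exists x.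
  intros z [H|H]; apply Hx; [exists u|exists v]; split; trivial; apply Hp; auto.
Qed.

Lemma add_bound u a : exists x, forall z, z ∈+ u \/ z = a -> z ∈+ x.
Proof.
  destruct (sing_exists a) as [s Hs], (union_bound u s) as [x Hx]. exists x.
  intros z [H|H]; apply Hx; [|right; apply Hs]; auto.
Qed.

(** * Numerals and codes *)

Definition succ_pos (x z : V) : Prop := z ∈+ x \/ z = x.
Definition succ_neg (x z : V) : Prop := z ∈- x /\ ~ z = x.

Lemma truth_succ w x z a c : denotes w x a -> denotes w z c ->
  truth w (succ x z) (succ_pos a c).
Proof. intros. unfold succ, sing, succ_pos. sem. Qed.

Lemma falsity_succ w x z a c : denotes w x a -> denotes w z c ->
  falsity w (succ x z) (succ_neg a c).
Proof. intros. unfold succ, sing, succ_neg. sem. Qed.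
Hint Resolve truth_succ falsity_succ : sem.

(** The truth and falsity conditions of [numeral k z]. The description [the] inside the successor
    case is existential for truth and universal for falsity; the two match once the numeral is known
    to exist uniquely. *)
Fixpoint num_pos (k : nat) : V -> Prop :=
  match k with
  | O => fun _ => False
  | S j => fun z => exists x, has_members x (num_pos j) (num_neg j) /\ succ_pos x z
  end
with num_neg (k : nat) : V -> Prop :=
  match k with
  | O => fun _ => True
  | S j => fun z => forall x, has_members x (num_pos j) (num_neg j) -> succ_neg x z
  end.

Definition num_eq (k : nat) (z : V) : Prop := has_members z (num_pos k) (num_neg k).

Lemma numeral_sem k : forall w z a, denotes w z a ->
  truth w (numeral k z) (num_pos k a) /\ falsity w (numeral k z) (num_neg k a).
Proof.
  induction k as [|k IH]; intros w z a Hz.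
  - split; cbv; tauto.
  - assert (IHt : forall w z a, denotes w z a -> truth w (numeral k z) (num_pos k a))
      by (intros; now apply IH).
    assert (IHf : forall w z a, denotes w z a -> falsity w (numeral k z) (num_neg k a))
      by (intros; now apply IH).
    split; simpl; sem.
Qed.

Lemma truth_numeral w k z a : denotes w z a -> truth w (is_set z (numeral k)) (num_eq k a).
Proof. intros. apply truth_is_set; trivial; intros; now apply numeral_sem. Qed.

Lemma num_exists k : exists z, num_eq k z.
Proof.
  induction k as [|k [x Hx]].
  - destruct empty_exists as [z Hz]. exists z. intros y. destruct (Hz y). simpl. tauto.
  (* Uniqueness of the predecessor collapses both quantifiers of the successor case to this [x]. *)
  - assert (E : forall x', has_members x' (num_pos k) (num_neg k) <-> x = x').
    { intros x'. split; [now apply eq_members|now intros <-]. }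
    destruct (crisp_superset x) as [c [_ Hc]], (add_bound c x) as [u Hu].
    edestruct (mk_set (push (world0 x) x)) with (P := succ_pos x) (Q := fun z => succ_neg x z)
      (u := u) as [z Hz].
    + intros. unfold succ_pos. define.
    + intros. unfold succ_neg. define.
    + intros z [[H|H]|H]; apply Hu; auto. unfold succ_neg in H.
      destruct (classic (z = x)); auto. left; apply Hc. right; tauto.
    + exists z. intros y. destruct (Hz y) as [H1 H2]. simpl. rewrite H1, H2. split; split.
      * intros H. now exists x.
      * intros [x' [H H']]. apply E in H. now subst x'.
      * intros H x' H'. apply E in H'. now subst x'.
      * intros H. now apply H.
Qed.

Definition code_eq (k : nat) (u v w : V) : Prop :=
  exists i, num_eq k i /\ exists p, kpair_eq u v p /\ kpair_eq i p w.
Hint Resolve truth_numeral : sem define.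

Lemma truth_is_code W k u v w a b c :
  denotes W u a -> denotes W v b -> denotes W w c ->
  truth W (is_code k u v w) (code_eq k a b c).
Proof. intros. unfold is_code, code_eq. sem. Qed.
Hint Resolve truth_is_code : sem define.

Lemma code_exists k u v : exists w, code_eq k u v w.
Proof.
  destruct (num_exists k) as [i Hi], (kpair_exists u v) as [p Hp], (kpair_exists i p) as [w Hw].
  exists w, i; eauto.
Qed.

Lemma code_unique k u v w w' : code_eq k u v w -> code_eq k u v w' -> w = w'.
Proof.
  intros [i [Hi [p [Hp H]]]] [i' [Hi' [p' [Hp' H']]]].
  assert (i = i') by (eapply eq_members; eassumption). subst i'.
  assert (p = p') by (eapply kpair_unique; eassumption). subst p'.
  eapply kpair_unique; eassumption.
Qed.

Lemma code_inj k u v u' v' w : code_eq k u v w -> code_eq k u' v' w -> u = u' /\ v = v'.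
Proof.
  intros [i [Hi [p [Hp H]]]] [i' [Hi' [p' [Hp' H']]]].
  destruct (kpair_inj _ _ _ _ _ H H') as [_ ->].
  eapply kpair_inj; eassumption.
Qed.

(** ** Ordered pairs *)

(** Keeps the tags ∅ and {∅} of ordered pairs apart. *)
Lemma empty_not_sing e : empty_eq e -> ~ sing_eq e e.
Proof. intros He Ho. now apply (proj1 (He e)), Ho. Qed.

Lemma tag_left e A B x z : empty_eq e -> kpair_eq x e z -> (tag A B z <-> A x).
Proof.
  intros He Hz. split.
  - intros [[x' [[e' [He' Hz']] H]]|[y [[e' [He' [o [Ho Hz']]]] _]]].
    + now destruct (kpair_inj _ _ _ _ _ Hz Hz') as [-> _].
    + destruct (kpair_inj _ _ _ _ _ Hz Hz') as [_ ->].
      rewrite (eq_classes _ _ _ He' He) in Ho. destruct (empty_not_sing _ He Ho).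
  - intros H. left. exists x. split; [|exact H]. now exists e.
Qed.

Lemma tag_right e o A B y z :
  empty_eq e -> sing_eq e o -> kpair_eq y o z -> (tag A B z <-> B y).
Proof.
  intros He Ho Hz. split.
  - intros [[x [[e' [He' Hz']] _]]|[y' [[e' [He' [o' [Ho' Hz']]]] H]]].
    + destruct (kpair_inj _ _ _ _ _ Hz Hz') as [_ ->].
      rewrite (eq_classes _ _ _ He He') in Ho. destruct (empty_not_sing _ He' Ho).
    + now destruct (kpair_inj _ _ _ _ _ Hz Hz') as [-> _].
  - intros H. right. exists y. split; [|exact H]. exists e; split; [exact He|now exists o].
Qed.

(** The bound is uniform in [A] and [B], so one set bounds both the ! half and the ? half of an
    ordered pair. *)
Lemma tag_bound u v : exists x, forall A B : V -> Prop,
  (forall a, A a -> a ∈+ u) -> (forall b, B b -> b ∈+ v) -> forall z, tag A B z -> z ∈+ x.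
Proof.
  destruct empty_exists as [e He], (sing_exists e) as [o Ho].
  edestruct (image (push (world0 e) e)) with (R := fun a z => kpair_eq a e z) (u := u)
    as [i Hi]; [intros; define|intros; eapply kpair_unique; eassumption|].
  edestruct (image (push (world0 o) o)) with (R := fun a z => kpair_eq a o z) (u := v)
    as [j Hj]; [intros; define|intros; eapply kpair_unique; eassumption|].
  destruct (union_bound i j) as [x Hx]. exists x.
  intros A B HA HB z [[a [[e' [He' Hz]] H]]|[b [[e' [He' [o' [Ho' Hz]]]] H]]]; apply Hx.
  - rewrite (eq_classes _ _ _ He' He) in Hz. left. apply Hi. eauto.
  - rewrite (eq_classes _ _ _ He' He) in Ho'. rewrite (eq_classes _ _ _ Ho' Ho) in Hz.
    right. apply Hj. eauto.
Qed.

Lemma opair_exists a b : exists p, opair_eq a b p.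
Proof.
  destruct (crisp_superset a) as [ca [_ Ha]], (crisp_superset b) as [cb [_ Hb]],
    (tag_bound ca cb) as [u Hu].
  edestruct (mk_set (push (push (world0 a) a) b))
    with (P := tag (fun x => x ∈+ a) (fun y => y ∈+ b))
         (Q := fun z => ~ tag (fun x => ~ x ∈- a) (fun y => ~ y ∈- b) z) (u := u) as [p Hp].
  - intros. unfold tag. define.
  - intros. unfold tag. define.
  - intros z [H|H]; [|apply NNPP in H]; revert H; apply Hu; intros; auto.
  - exists p. split; intros z; destruct (Hp z) as [H1 H2]; [exact H1|].
    rewrite H2. split; [apply NNPP|tauto].
Qed.

Lemma opair_unique a b p q : opair_eq a b p -> opair_eq a b q -> p = q.
Proof.
  intros [H1 H2] [H3 H4]. apply extensionality. intros z.
  specialize (H1 z). specialize (H2 z). specialize (H3 z). specialize (H4 z).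
  split; [tauto|]. destruct (classic (z ∈- p)), (classic (z ∈- q)); tauto.
Qed.

(** Both kinds of membership of x in the first component are read off from ⟨x,∅⟩, and in the second
    component from ⟨x,{∅}⟩; this recovers non-classical components as well. *)
Lemma opair_inj a b c d p : opair_eq a b p -> opair_eq c d p -> a = c /\ b = d.
Proof.
  intros [H1 H2] [H3 H4].
  destruct empty_exists as [e He], (sing_exists e) as [o Ho].
  split; apply extensionality; intros x.
  - destruct (kpair_exists x e) as [z Hz].
    specialize (H1 z). specialize (H2 z). specialize (H3 z). specialize (H4 z).
    rewrite (tag_left _ _ _ _ _ He Hz) in H1. rewrite (tag_left _ _ _ _ _ He Hz) in H2.
    rewrite (tag_left _ _ _ _ _ He Hz) in H3. rewrite (tag_left _ _ _ _ _ He Hz) in H4.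
    split; [tauto|]. destruct (classic (x ∈- a)), (classic (x ∈- c)); tauto.
  - destruct (kpair_exists x o) as [z Hz].
    specialize (H1 z). specialize (H2 z). specialize (H3 z). specialize (H4 z).
    rewrite (tag_right _ _ _ _ _ _ He Ho Hz) in H1. rewrite (tag_right _ _ _ _ _ _ He Ho Hz) in H2.
    rewrite (tag_right _ _ _ _ _ _ He Ho Hz) in H3. rewrite (tag_right _ _ _ _ _ _ He Ho Hz) in H4.
    split; [tauto|]. destruct (classic (x ∈- b)), (classic (x ∈- d)); tauto.
Qed.

Lemma pair_in_iff a b p R : opair_eq a b p -> (pair_in a b R <-> p ∈+ R).
Proof.
  intros H; split; [|now exists p]. intros [q [Hq K]].
  now rewrite (opair_unique _ _ _ _ H Hq).
Qed.

Lemma pair_notin_iff a b p R : opair_eq a b p -> (pair_notin a b R <-> p ∈- R).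
Proof.
  intros H; split; [intros K; now apply K|]. intros K q Hq.
  now rewrite (opair_unique _ _ _ _ Hq H).
Qed.

Lemma pair_notin_crisp a b R : crisp R -> (pair_notin a b R <-> ~ pair_in a b R).
Proof.
  intros HR. destruct (opair_exists a b) as [p Hp].
  rewrite (pair_in_iff _ _ _ _ Hp), (pair_notin_iff _ _ _ _ Hp). specialize (HR p).
  destruct (classic (p ∈- R)); tauto.
Qed.
Hint Resolve truth_cfun_raw : sem.

Lemma truth_cfun w f A B a b g :
  denotes w f g -> denotes w A a -> denotes w B b -> truth w (cfun f A B) (maps g a b).
Proof.
  intros. eapply truth_iff; [sem|]. unfold maps. split.
  - intros [Hg [Hs [Ha Hf]]]. split; [exact Hg|].
    (* [a] is the domain of the crisp [g], where having all pairs as non-members is the same as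
       having no value. *)
    assert (Ca : crisp a).
    { intros x. destruct (Ha x) as [E1 E2]. rewrite E1, E2. split.
      - intros [y Hy] K. now apply (pair_notin_crisp x y g Hg).
      - intros K. apply NNPP. intros N. apply K. intros y. apply pair_notin_crisp; eauto. }
    split; [|split; [exact Ca|split; [intros x; apply Ha|eauto]]].
    intros z Hz. destruct (Hs z) as [E1 E2].
    destruct (E1 Hz) as [x [y [Hxy [Hx Hy]]]]. exists x, y.
    split; [exact Hxy|]. split; [exact Hx|]. split; [exact Hy|].
    intros N. apply (proj1 (Hg z) Hz), E2. intros x' y'.
    destruct (classic (opair_eq x' y' z)) as [K|K]; [|tauto].
    destruct (opair_inj _ _ _ _ _ Hxy K) as [<- <-]. tauto.
  - intros [Hg [Hs [Ha [Ht Hf]]]].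
    assert (Hd : forall x, x ∈+ a <-> exists y, pair_in x y g).
    { intros x; split; [apply Ht|]. intros [y [p [Hp Hpg]]].
      destruct (Hs p Hpg) as [x' [y' [Hp' [Hx' _]]]].
      now destruct (opair_inj _ _ _ _ _ Hp Hp') as [-> _]. }
    split; [exact Hg|]. split; [|split].
    + intros z. split.
      * intros Hz. destruct (Hs z Hz) as [x [y K]]. exists x, y. tauto.
      * intros K. apply NNPP. intros N. apply Hg in N.
        destruct (Hs z N) as [x [y [Hxy [Hx [_ Hy]]]]]. apply Ha in Hx.
        destruct (K x y) as [?|[?|?]]; tauto.
    + intros x. split; [apply Hd|]. split.
      * intros K z. apply pair_notin_crisp; trivial. intros N.
        apply (proj1 (Ha x)); trivial. apply Hd. now exists z.
      * intros K. apply NNPP. intros N. apply Ha, Hd in N. destruct N as [z N].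
        now apply (pair_notin_crisp x z g Hg) in N.
    + intros x y z [Hy Hz]. eapply Hf; eassumption.
Qed.
Hint Resolve truth_cfun : sem define.

Definition maps_from (f A : V) : Prop := exists B, maps f A B.

Lemma truth_cfun_on w f A g a :
  denotes w f g -> denotes w A a -> truth w (cfun_on f A) (maps_from g a).
Proof. intros. unfold cfun_on, maps_from. sem. Qed.
Hint Resolve truth_cfun_on : sem define.

(** * Meaning of the coded syntax *)

Definition inductive_set (I : V) : Prop :=
  (exists e, empty_eq e /\ e ∈+ I) /\
  forall y, y ∈+ I -> exists s, has_members s (succ_pos y) (succ_neg y) /\ s ∈+ I.

Lemma truth_inductive w I i : denotes w I i -> truth w (inductive I) (inductive_set i).
Proof. intros. unfold inductive, inductive_set. sem. Qed.
Hint Resolve truth_inductive : sem.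

Definition in_omega (n : V) : Prop := forall I, inductive_set I -> n ∈+ I.

Lemma decided_omega w n a : denotes w n a -> decided w (omega n) (in_omega a).
Proof. intros. apply decided_bang. unfold in_omega. sem. Qed.

Lemma truth_omega w n a : denotes w n a -> truth w (omega n) (in_omega a).
Proof. intros; now apply decided_omega. Qed.
Hint Resolve decided_omega : sem.
Hint Resolve truth_omega : define sem.

Definition tvar_eq (n t : V) : Prop := exists k, num_eq 0 k /\ kpair_eq k n t.
Definition tcon_eq (c t : V) : Prop := exists k, num_eq 1 k /\ kpair_eq k c t.

Lemma truth_is_tvar w n t a b : denotes w n a -> denotes w t b ->
  truth w (is_tvar n t) (tvar_eq a b).
Proof. intros. unfold is_tvar, tvar_eq. sem. Qed.

Lemma truth_is_tcon w n t a b : denotes w n a -> denotes w t b ->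
  truth w (is_tcon n t) (tcon_eq a b).
Proof. intros. unfold is_tcon, tcon_eq. sem. Qed.
Hint Resolve truth_is_tvar truth_is_tcon : sem define.

Definition is_term (C t : V) : Prop :=
  (exists n, in_omega n /\ tvar_eq n t) \/ (exists c, c ∈+ C /\ tcon_eq c t).

Lemma decided_term w C t c a : denotes w C c -> denotes w t a ->
  decided w (term C t) (is_term c a).
Proof. intros. apply decided_bang. unfold is_term. sem. Qed.
Hint Resolve decided_term : sem.

Definition bot_eq (w : V) : Prop := exists e, empty_eq e /\ code_eq 2 e e w.

Lemma truth_is_bot w b c : denotes w b c -> truth w (is_bot b) (bot_eq c).
Proof. intros. unfold is_bot, bot_eq. sem. Qed.

Lemma truth_is_eql W u v w a b c : denotes W u a -> denotes W v b -> denotes W w c ->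
  truth W (is_eql u v w) (code_eq 0 a b c).
Proof. apply truth_is_code. Qed.

Lemma truth_is_rel W u v w a b c : denotes W u a -> denotes W v b -> denotes W w c ->
  truth W (is_rel u v w) (code_eq 1 a b c).
Proof. apply truth_is_code. Qed.

Lemma truth_is_neg W u w a c : denotes W u a -> denotes W w c ->
  truth W (is_neg u w) (code_eq 3 a a c).
Proof. intros. unfold is_neg. sem. Qed.

Lemma truth_is_and W u v w a b c : denotes W u a -> denotes W v b -> denotes W w c ->
  truth W (is_and u v w) (code_eq 4 a b c).
Proof. apply truth_is_code. Qed.

Lemma truth_is_or W u v w a b c : denotes W u a -> denotes W v b -> denotes W w c ->
  truth W (is_or u v w) (code_eq 5 a b c).
Proof. apply truth_is_code. Qed.

Lemma truth_is_imp W u v w a b c : denotes W u a -> denotes W v b -> denotes W w c ->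
  truth W (is_imp u v w) (code_eq 6 a b c).
Proof. apply truth_is_code. Qed.

Lemma truth_is_all W u v w a b c : denotes W u a -> denotes W v b -> denotes W w c ->
  truth W (is_all u v w) (code_eq 7 a b c).
Proof. apply truth_is_code. Qed.

Lemma truth_is_ex W u v w a b c : denotes W u a -> denotes W v b -> denotes W w c ->
  truth W (is_ex u v w) (code_eq 8 a b c).
Proof. apply truth_is_code. Qed.
Hint Resolve truth_is_bot truth_is_eql truth_is_rel truth_is_neg truth_is_and truth_is_or
  truth_is_imp truth_is_all truth_is_ex : sem.
Hint Resolve truth_is_bot : define.

Definition is_arguments (C P ar R ts : V) : Prop :=
  R ∈+ P /\ exists n, pair_in R n ar /\ exists TS, is_class TS (is_term C) /\ maps ts n TS.

Lemma truth_arguments w C P ar R ts c p r a b :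
  denotes w C c -> denotes w P p -> denotes w ar r -> denotes w R a -> denotes w ts b ->
  truth w (arguments C P ar R ts) (is_arguments c p r a b).
Proof. intros. unfold arguments, is_arguments. sem. Qed.
Hint Resolve truth_arguments : sem.

Definition closed_under_formation (C P ar X : V) : Prop :=
  (forall s t w, is_term C s -> is_term C t -> code_eq 0 s t w -> w ∈+ X) /\
  (forall R ts w, is_arguments C P ar R ts -> code_eq 1 R ts w -> w ∈+ X) /\
  (forall w, bot_eq w -> w ∈+ X) /\
  (forall p w, p ∈+ X -> code_eq 3 p p w -> w ∈+ X) /\
  (forall p q w, p ∈+ X -> q ∈+ X ->
     code_eq 4 p q w \/ code_eq 5 p q w \/ code_eq 6 p q w -> w ∈+ X) /\
  (forall n p w, in_omega n -> p ∈+ X -> code_eq 7 n p w \/ code_eq 8 n p w -> w ∈+ X).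

Lemma truth_formula_closed w C P ar X c p r x :
  denotes w C c -> denotes w P p -> denotes w ar r -> denotes w X x ->
  truth w (formula_closed C P ar X) (closed_under_formation c p r x).
Proof. intros. unfold formula_closed, closed_under_formation. sem. Qed.
Hint Resolve truth_formula_closed : sem.

(** An intersection over closed sets: closure under formation is immediate, and the formulas are
    never collected into a set. *)
Definition is_formula (C P ar w : V) : Prop :=
  forall X, closed_under_formation C P ar X -> w ∈+ X.

Lemma decided_formula w C P ar X c p r x :
  denotes w C c -> denotes w P p -> denotes w ar r -> denotes w X x ->
  decided w (formula C P ar X) (is_formula c p r x).
Proof. intros. apply decided_bang. unfold is_formula. sem. Qed.
Hint Resolve decided_formula : sem.

Lemma decided_power w M n z m a b : denotes w M m -> denotes w n a -> denotes w z b ->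
  decided w (power M n z) (maps b a m).
Proof. intros. apply decided_bang. sem. Qed.
Hint Resolve decided_power : sem.

Definition is_assignment (M a : V) : Prop :=
  exists w, is_class w in_omega /\ maps a w M.

Lemma truth_assignment w M a m b : denotes w M m -> denotes w a b ->
  truth w (assignment M a) (is_assignment m b).
Proof. intros. unfold assignment, is_assignment. sem. Qed.
Hint Resolve truth_assignment : sem define.

Definition update_eq (M a n m a' : V) : Prop :=
  is_assignment M a' /\
  forall k x, in_omega k ->
    (pair_in k x a' <-> k = n /\ x = m \/ ~ k = n /\ pair_in k x a).

Lemma truth_is_update w M a n m a' M_ a_ n_ m_ a'_ :
  denotes w M M_ -> denotes w a a_ -> denotes w n n_ -> denotes w m m_ -> denotes w a' a'_ ->
  truth w (is_update M a n m a') (update_eq M_ a_ n_ m_ a'_).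
Proof. intros. unfold is_update, update_eq. sem. Qed.
Hint Resolve truth_is_update : sem.

Lemma truth_the_update w M a n m psi M_ a_ n_ m_ P :
  denotes w M M_ -> denotes w a a_ -> denotes w n n_ -> denotes w m m_ ->
  (forall w' x b, ext w w' -> denotes w' x b -> truth w' (psi x) (P b)) ->
  truth w (the_update M a n m psi) (exists a', update_eq M_ a_ n_ m_ a' /\ P a').
Proof. intros. unfold the_update. sem. Qed.

Lemma falsity_the_update w M a n m psi M_ a_ n_ m_ P :
  denotes w M M_ -> denotes w a a_ -> denotes w n n_ -> denotes w m m_ ->
  (forall w' x b, ext w w' -> denotes w' x b -> falsity w' (psi x) (P b)) ->
  falsity w (the_update M a n m psi) (forall a', update_eq M_ a_ n_ m_ a' -> P a').
Proof.
  intros. eapply falsity_iff with (P := forall a', ~ update_eq M_ a_ n_ m_ a' \/ P a');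
    [unfold the_update; sem|].
  split; intros K a'; specialize (K a'); [tauto|].
  destruct (classic (update_eq M_ a_ n_ m_ a')); tauto.
Qed.
Hint Resolve truth_the_update falsity_the_update : sem.

Definition value_eq (c a t x : V) : Prop :=
  (exists n, in_omega n /\ tvar_eq n t /\ pair_in n x a) \/
  (exists k, tcon_eq k t /\ pair_in k x c).

Lemma truth_value w c a t x c_ a_ t_ x_ :
  denotes w c c_ -> denotes w a a_ -> denotes w t t_ -> denotes w x x_ ->
  truth w (value c a t x) (value_eq c_ a_ t_ x_).
Proof. intros. unfold value, value_eq. sem. Qed.
Hint Resolve truth_value : sem.

Definition values_eq (M ar c a R ts b : V) : Prop :=
  exists n, pair_in R n ar /\ maps b n M /\
    forall i t x, pair_in i t ts -> pair_in i x b -> value_eq c a t x.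

Lemma truth_values w M ar c a R ts b M_ ar_ c_ a_ R_ ts_ b_ :
  denotes w M M_ -> denotes w ar ar_ -> denotes w c c_ -> denotes w a a_ ->
  denotes w R R_ -> denotes w ts ts_ -> denotes w b b_ ->
  truth w (values M ar c a R ts b) (values_eq M_ ar_ c_ a_ R_ ts_ b_).
Proof. intros. unfold values, values_eq. sem. Qed.
Hint Resolve truth_values : sem.

(** * Meaning of the two internal semantics *)

Definition is_domain (M : V) : Prop := crisp M /\ exists m, m ∈+ M.

Definition is_tarski_model (C P ar M c r : V) : Prop :=
  is_domain M /\ maps c C M /\ maps_from r P /\
  forall R n i, pair_in R n ar -> pair_in R i r ->
    forall b, (b ∈+ i -> maps b n M) /\ (~ maps b n M -> b ∈- i).

Lemma truth_tarski_model w C P ar M c r C_ P_ ar_ M_ c_ r_ :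
  denotes w C C_ -> denotes w P P_ -> denotes w ar ar_ -> denotes w M M_ ->
  denotes w c c_ -> denotes w r r_ ->
  truth w (tarski_model C P ar M c r) (is_tarski_model C_ P_ ar_ M_ c_ r_).
Proof. intros. unfold tarski_model, is_tarski_model, domain, is_domain, elts. sem. Qed.
Hint Resolve truth_tarski_model : sem.

(** Each strong equivalence splits into a clause for [pair_in] and one for [pair_notin]. In the
    quantifier clauses the updated assignment is existentially quantified in the first and
    universally in the second, because it enters through a description. *)
Definition satisfies_tarski_clauses (C P ar M c r Sat : V) : Prop :=
  (forall s t w a x y, is_term C s -> is_term C t -> code_eq 0 s t w -> is_assignment M a ->
     value_eq c a s x -> value_eq c a t y ->
     (pair_in w a Sat <-> x = y) /\ (pair_notin w a Sat <-> eql_neg V x y)) /\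
  (forall R ts w a i b, is_arguments C P ar R ts -> code_eq 1 R ts w -> is_assignment M a ->
     pair_in R i r -> values_eq M ar c a R ts b ->
     (pair_in w a Sat <-> b ∈+ i) /\ (pair_notin w a Sat <-> b ∈- i)) /\
  (forall w a, bot_eq w -> is_assignment M a ->
     (pair_in w a Sat <-> False) /\ (pair_notin w a Sat <-> ~ False)) /\
  (forall p w a, is_formula C P ar p -> code_eq 3 p p w -> is_assignment M a ->
     (pair_in w a Sat <-> pair_notin p a Sat) /\ (pair_notin w a Sat <-> pair_in p a Sat)) /\
  (forall p q w a, is_formula C P ar p -> is_formula C P ar q -> is_assignment M a ->
     (code_eq 4 p q w ->
       (pair_in w a Sat <-> pair_in p a Sat /\ pair_in q a Sat) /\
       (pair_notin w a Sat <-> pair_notin p a Sat \/ pair_notin q a Sat)) /\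
     (code_eq 5 p q w ->
       (pair_in w a Sat <-> pair_in p a Sat \/ pair_in q a Sat) /\
       (pair_notin w a Sat <-> pair_notin p a Sat /\ pair_notin q a Sat)) /\
     (code_eq 6 p q w ->
       (pair_in w a Sat <-> (pair_in p a Sat -> pair_in q a Sat)) /\
       (pair_notin w a Sat <-> pair_in p a Sat /\ pair_notin q a Sat))) /\
  (forall n p w a, in_omega n -> is_formula C P ar p -> is_assignment M a ->
     (code_eq 8 n p w ->
       (pair_in w a Sat <->
          exists m, m ∈+ M /\ exists a', update_eq M a n m a' /\ pair_in p a' Sat) /\
       (pair_notin w a Sat <->
          forall m, m ∈- M \/ forall a', update_eq M a n m a' -> pair_notin p a' Sat)) /\
     (code_eq 7 n p w ->
       (pair_in w a Sat <->
          forall m, m ∈+ M -> exists a', update_eq M a n m a' /\ pair_in p a' Sat) /\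
       (pair_notin w a Sat <->
          exists m, m ∈+ M /\ forall a', update_eq M a n m a' -> pair_notin p a' Sat))).

Lemma truth_tarski_clauses w C P ar M c r S C_ P_ ar_ M_ c_ r_ S_ :
  denotes w C C_ -> denotes w P P_ -> denotes w ar ar_ -> denotes w M M_ ->
  denotes w c c_ -> denotes w r r_ -> denotes w S S_ ->
  truth w (tarski_clauses C P ar M c r S) (satisfies_tarski_clauses C_ P_ ar_ M_ c_ r_ S_).
Proof. intros. unfold tarski_clauses, satisfies_tarski_clauses. sem. Qed.
Hint Resolve truth_tarski_clauses : sem.

Definition satisfied (C P ar M c r phi a : V) : Prop :=
  exists Sat, satisfies_tarski_clauses C P ar M c r Sat /\ pair_in phi a Sat.

Lemma truth_tarski_sat w C P ar M c r S a C_ P_ ar_ M_ c_ r_ S_ a_ :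
  denotes w C C_ -> denotes w P P_ -> denotes w ar ar_ -> denotes w M M_ ->
  denotes w c c_ -> denotes w r r_ -> denotes w S S_ -> denotes w a a_ ->
  truth w (tarski_sat C P ar M c r S a) (satisfied C_ P_ ar_ M_ c_ r_ S_ a_).
Proof. intros. unfold tarski_sat, satisfied. sem. Qed.
Hint Resolve truth_tarski_sat : sem.

Definition is_tf_model (C P ar M c rp rn ep en : V) : Prop :=
  is_domain M /\ maps c C M /\ maps_from rp P /\ maps_from rn P /\
  (forall R n i, pair_in R n ar -> pair_in R i rp \/ pair_in R i rn ->
     crisp i /\ forall b, (b ∈+ i -> maps b n M) /\ (~ maps b n M -> b ∈- i)) /\
  (crisp ep /\ forall z,
     (z ∈+ ep -> exists a b, opair_eq a b z /\ a ∈+ M /\ b ∈+ M) /\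
     ((forall a b, ~ opair_eq a b z \/ a ∈- M \/ b ∈- M) -> z ∈- ep)) /\
  (crisp en /\ forall z,
     (z ∈+ en -> exists a b, opair_eq a b z /\ a ∈+ M /\ b ∈+ M) /\
     ((forall a b, ~ opair_eq a b z \/ a ∈- M \/ b ∈- M) -> z ∈- en)) /\
  (forall a b, pair_in a b en -> pair_in b a en) /\
  (forall a b, a ∈+ M -> b ∈+ M -> (pair_in a b ep <-> a = b)).

Lemma truth_internal_tf_model w C P ar M c rp rn ep en C_ P_ ar_ M_ c_ rp_ rn_ ep_ en_ :
  denotes w C C_ -> denotes w P P_ -> denotes w ar ar_ -> denotes w M M_ ->
  denotes w c c_ -> denotes w rp rp_ -> denotes w rn rn_ -> denotes w ep ep_ ->
  denotes w en en_ ->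
  truth w (internal_tf_model C P ar M c rp rn ep en)
    (is_tf_model C_ P_ ar_ M_ c_ rp_ rn_ ep_ en_).
Proof.
  intros. unfold internal_tf_model, is_tf_model, domain, is_domain, elts, prod. sem.
Qed.
Hint Resolve truth_internal_tf_model : sem.

Definition satisfies_tf_clauses (C P ar M c rp rn ep en T F : V) : Prop :=
  crisp T /\ crisp F /\
  (forall s t w a x y, is_term C s -> is_term C t -> code_eq 0 s t w -> is_assignment M a ->
     value_eq c a s x -> value_eq c a t y ->
     (pair_in w a T <-> pair_in x y ep) /\ (pair_in w a F <-> pair_in x y en)) /\
  (forall R ts w a i j b, is_arguments C P ar R ts -> code_eq 1 R ts w -> is_assignment M a ->
     pair_in R i rp -> pair_in R j rn -> values_eq M ar c a R ts b ->
     (pair_in w a T <-> b ∈+ i) /\ (pair_in w a F <-> b ∈+ j)) /\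
  (forall w a, bot_eq w -> is_assignment M a -> ~ pair_in w a T /\ pair_in w a F) /\
  (forall p w a, is_formula C P ar p -> code_eq 3 p p w -> is_assignment M a ->
     (pair_in w a T <-> pair_in p a F) /\ (pair_in w a F <-> pair_in p a T)) /\
  (forall p q w a, is_formula C P ar p -> is_formula C P ar q -> is_assignment M a ->
     (code_eq 4 p q w ->
       (pair_in w a T <-> pair_in p a T /\ pair_in q a T) /\
       (pair_in w a F <-> pair_in p a F \/ pair_in q a F)) /\
     (code_eq 5 p q w ->
       (pair_in w a T <-> pair_in p a T \/ pair_in q a T) /\
       (pair_in w a F <-> pair_in p a F /\ pair_in q a F)) /\
     (code_eq 6 p q w ->
       (pair_in w a T <-> (pair_in p a T -> pair_in q a T)) /\
       (pair_in w a F <-> pair_in p a T /\ pair_in q a F))) /\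
  (forall n p w a, in_omega n -> is_formula C P ar p -> is_assignment M a ->
     (code_eq 8 n p w ->
       (pair_in w a T <->
          exists m, m ∈+ M /\ exists a', update_eq M a n m a' /\ pair_in p a' T) /\
       (pair_in w a F <->
          forall m, m ∈+ M -> exists a', update_eq M a n m a' /\ pair_in p a' F)) /\
     (code_eq 7 n p w ->
       (pair_in w a T <->
          forall m, m ∈+ M -> exists a', update_eq M a n m a' /\ pair_in p a' T) /\
       (pair_in w a F <->
          exists m, m ∈+ M /\ exists a', update_eq M a n m a' /\ pair_in p a' F))).

Lemma truth_tf_clauses w C P ar M c rp rn ep en T F C_ P_ ar_ M_ c_ rp_ rn_ ep_ en_ T_ F_ :
  denotes w C C_ -> denotes w P P_ -> denotes w ar ar_ -> denotes w M M_ ->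
  denotes w c c_ -> denotes w rp rp_ -> denotes w rn rn_ -> denotes w ep ep_ ->
  denotes w en en_ -> denotes w T T_ -> denotes w F F_ ->
  truth w (tf_clauses C P ar M c rp rn ep en T F)
    (satisfies_tf_clauses C_ P_ ar_ M_ c_ rp_ rn_ ep_ en_ T_ F_).
Proof. intros. unfold tf_clauses, satisfies_tf_clauses. sem. Qed.
Hint Resolve truth_tf_clauses : sem.

Definition tf_satisfied (C P ar M c rp rn ep en phi a : V) : Prop :=
  exists T F, satisfies_tf_clauses C P ar M c rp rn ep en T F /\ pair_in phi a T.

Lemma truth_tf_true w C P ar M c rp rn ep en phi a C_ P_ ar_ M_ c_ rp_ rn_ ep_ en_ phi_ a_ :
  denotes w C C_ -> denotes w P P_ -> denotes w ar ar_ -> denotes w M M_ ->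
  denotes w c c_ -> denotes w rp rp_ -> denotes w rn rn_ -> denotes w ep ep_ ->
  denotes w en en_ -> denotes w phi phi_ -> denotes w a a_ ->
  truth w (tf_true C P ar M c rp rn ep en phi a)
    (tf_satisfied C_ P_ ar_ M_ c_ rp_ rn_ ep_ en_ phi_ a_).
Proof. intros. unfold tf_true, tf_satisfied. sem. Qed.
Hint Resolve truth_tf_true : sem.

(** ** Functions *)

Lemma class_crisp x P : is_class x P -> crisp x.
Proof. intros H z. destruct (H z) as [H1 H2]. rewrite H1, H2. destruct (classic (P z)); tauto. Qed.

Lemma crisp_notin x z : crisp x -> (z ∈- x <-> ~ z ∈+ x).
Proof. intros H. specialize (H z). destruct (classic (z ∈- x)); tauto. Qed.

Lemma crisp_eq x y : crisp x -> crisp y -> (forall z, z ∈+ x <-> z ∈+ y) -> x = y.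
Proof.
  intros Hx Hy H. apply extensionality. intros z.
  rewrite (crisp_notin _ z Hx), (crisp_notin _ z Hy), (H z). tauto.
Qed.

Lemma maps_pair f A B x y : maps f A B -> pair_in x y f -> x ∈+ A /\ y ∈+ B.
Proof.
  intros [_ [H _]] [p [Hp Hf]]. destruct (H p Hf) as [a [b [Hab [Ha [Hb _]]]]].
  now destruct (opair_inj _ _ _ _ _ Hp Hab) as [-> ->].
Qed.

Lemma maps_dom f A B x y : maps f A B -> pair_in x y f -> x ∈+ A.
Proof. intros Hf Hx. exact (proj1 (maps_pair _ _ _ _ _ Hf Hx)). Qed.

Lemma maps_cod f A B x y : maps f A B -> pair_in x y f -> y ∈+ B.
Proof. intros Hf Hx. exact (proj2 (maps_pair _ _ _ _ _ Hf Hx)). Qed.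

Lemma maps_total f A B x : maps f A B -> x ∈+ A -> exists y, pair_in x y f.
Proof. intros H. apply H. Qed.

Lemma maps_functional f A B x y z : maps f A B -> pair_in x y f -> pair_in x z f -> y = z.
Proof. intros H. apply H. Qed.

Lemma maps_eq f g A B A' B' : maps f A B -> maps g A' B' ->
  (forall x y, pair_in x y f <-> pair_in x y g) -> f = g.
Proof.
  intros [Hf [Hf' _]] [Hg [Hg' _]] H. apply crisp_eq; trivial. intros z. split; intros Hz.
  - destruct (Hf' z Hz) as [a [b [Hab _]]].
    apply (pair_in_iff _ _ _ _ Hab), H. now exists z.
  - destruct (Hg' z Hz) as [a [b [Hab _]]].
    apply (pair_in_iff _ _ _ _ Hab), H. now exists z.
Qed.

(** The function is the image of [A] under a ↦ (a,b); crispness of [B] supplies the condition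
    [~ b ∈- B] of [maps]. *)
Lemma function_exists w G (R : V -> V -> Prop) A B :
  (forall w' x y a b, ext w w' -> denotes w' x a -> denotes w' y b ->
     truth w' (G x y) (R a b)) ->
  crisp A -> crisp B ->
  (forall x, x ∈+ A -> exists y, y ∈+ B /\ R x y /\ forall z, R x z -> y = z) ->
  exists f, maps f A B /\ forall x y, pair_in x y f <-> x ∈+ A /\ R x y.
Proof.
  intros HG HA HB H.
  assert (Hfun : forall x y z, x ∈+ A -> R x y -> R x z -> y = z).
  { intros x y z Hx Hy Hz. destruct (H x Hx) as [y' [_ [_ K]]].
    now rewrite <- (K y Hy), <- (K z Hz). }
  edestruct (image w) with (R := fun a p => exists b, R a b /\ opair_eq a b p) (u := A)
    as [f Hf].
  - intros w' x y a b E Hx Hy.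
    assert (forall w'' z c, ext w' w'' -> denotes w'' z c -> truth w'' (G x z) (R a c))
      by eauto using ext_trans, denotes_ext.
    define.
  - intros a p q Ha [b [Hb Hp]] [c [Hc Hq]].
    rewrite (Hfun a b c Ha Hb Hc) in Hp. eapply opair_unique; eassumption.
  - assert (Hin : forall x y, pair_in x y f <-> x ∈+ A /\ R x y).
    { intros x y. destruct (opair_exists x y) as [p Hp]. rewrite (pair_in_iff _ _ _ _ Hp).
      rewrite (proj1 (Hf p)). split.
      - intros [a [Ha [b [Hb Hp']]]]. now destruct (opair_inj _ _ _ _ _ Hp Hp') as [-> ->].
      - intros [Hx Hy]. eauto. }
    exists f. split; [|exact Hin]. split; [|split; [|split; [|split]]].
    + eapply class_crisp, Hf.
    + intros z Hz. apply Hf in Hz. destruct Hz as [a [Ha [b [Hb Hz]]]]. exists a, b.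
      destruct (H a Ha) as [y [Hy [_ K]]]. rewrite (K b Hb) in Hy.
      split; [exact Hz|]. split; [exact Ha|]. split; [exact Hy|]. now apply HB.
    + exact HA.
    + intros x Hx. destruct (H x Hx) as [y [_ [Hy _]]]. exists y. now apply Hin.
    + intros x y z Hy Hz. apply Hin in Hy, Hz. eapply Hfun; [apply Hy|apply Hy|apply Hz].
Qed.

(** For interpretations of relation symbols, which come without a codomain: the image of [A] serves
    as one. *)
Lemma function_from_exists w G (R : V -> V -> Prop) A :
  (forall w' x y a b, ext w w' -> denotes w' x a -> denotes w' y b ->
     truth w' (G x y) (R a b)) ->
  crisp A ->
  (forall x, x ∈+ A -> exists y, R x y /\ forall z, R x z -> y = z) ->
  exists f B, maps f A B /\ is_class B (fun y => exists x, x ∈+ A /\ R x y) /\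
    forall x y, pair_in x y f <-> x ∈+ A /\ R x y.
Proof.
  intros HG HA H.
  assert (HR : forall a b c, a ∈+ A -> R a b -> R a c -> b = c).
  { intros a b c Ha Hb Hc. destruct (H a Ha) as [y [_ K]].
    now rewrite <- (K b Hb), <- (K c Hc). }
  destruct (image w G R A HG HR) as [B HB].
  destruct (function_exists w G R A B HG HA (class_crisp _ _ HB)) as [f Hf].
  - intros x Hx. destruct (H x Hx) as [y [Hy K]]. exists y.
    split; [|split; assumption]. apply HB. now exists x.
  - exists f, B. tauto.
Qed.

(** Each {x}×B is an image of [B]; these sets are collected by a second image and united. *)
Lemma product_bound A B : exists u, forall x y p,
  x ∈+ A -> y ∈+ B -> opair_eq x y p -> p ∈+ u.
Proof.
  edestruct (image (push (world0 B) B))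
    with (R := fun x s => is_class s (fun p => exists y, y ∈+ B /\ opair_eq x y p)) (u := A)
    as [v Hv].
  - intros. define.
  - intros. eapply eq_classes; eassumption.
  - destruct (union v) as [u Hu]. exists u. intros x y p Hx Hy Hp. apply Hu.
    edestruct (image (push (push (world0 B) B) x))
      with (R := fun y p => opair_eq x y p) (u := B) as [s Hs].
    + intros. define.
    + intros. eapply opair_unique; eassumption.
    + exists s. split; [apply Hs; eauto|]. apply Hv. exists x. split; assumption.
Qed.

(** Power Set speaks of strong inclusion. In a classical superset [c] of the product, the positive
    inclusion of a crisp [f] already yields the negative one. *)
Lemma power_bound n M : exists u, forall f, maps f n M -> f ∈+ u.
Proof.
  destruct (product_bound n M) as [v Hv], (crisp_superset v) as [c [Hc Hvc]],
    (power_set c) as [u Hu].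
  exists u. intros f [Hf [Hp _]]. apply Hu.
  assert (K : forall z, z ∈+ f -> z ∈+ c).
  { intros z Hz. destruct (Hp z Hz) as [a [b [Hab [Ha [Hb _]]]]]. apply Hvc. eauto. }
  intros z. split; [apply K|]. rewrite (crisp_notin _ _ Hc), (crisp_notin _ _ Hf). auto.
Qed.

Lemma assignment_pair M a n x : is_assignment M a -> pair_in n x a -> in_omega n /\ x ∈+ M.
Proof.
  intros [w [Hw Ha]] Hn. destruct (maps_pair _ _ _ _ _ Ha Hn). split; [now apply Hw|assumption].
Qed.

Lemma assignment_eq M a b : is_assignment M a -> is_assignment M b ->
  (forall n x, in_omega n -> (pair_in n x a <-> pair_in n x b)) -> a = b.
Proof.
  intros Ha Hb H.
  assert (K : forall n x, pair_in n x a <-> pair_in n x b).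
  { intros n x. split; intros J; apply H; trivial; eapply assignment_pair; try apply J;
      eassumption. }
  destruct Ha as [w [_ Ha]], Hb as [w' [_ Hb]]. eapply maps_eq; eassumption.
Qed.

Lemma update_exists M a n m : crisp M -> is_assignment M a -> in_omega n -> m ∈+ M ->
  exists a', update_eq M a n m a'.
Proof.
  intros HM Ha Hn Hm. destruct Ha as [w [Hw Ha]].
  edestruct (function_exists (push (push (push (world0 a) a) n) m))
    with (R := fun k x => k = n /\ x = m \/ ~ k = n /\ pair_in k x a) (A := w) (B := M)
    as [f [Hf Hin]].
  - intros. define.
  - eapply class_crisp, Hw.
  - exact HM.
  - intros k Hk. destruct (classic (k = n)) as [->|K].
    + exists m. split; [exact Hm|]. split; [tauto|]. intros z [[_ ->]|[? _]]; tauto.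
    + destruct (maps_total _ _ _ _ Ha Hk) as [x Hx]. exists x.
      split; [eauto using maps_dom, maps_cod|]. split; [tauto|].
      intros z [[? _]|[_ Hz]]; [tauto|]. eapply maps_functional; eassumption.
  - exists f. split; [now exists w|]. intros k x Hk. rewrite Hin, (proj1 (Hw k)). tauto.
Qed.

Lemma update_unique M a n m b c : update_eq M a n m b -> update_eq M a n m c -> b = c.
Proof.
  intros [Hb Hb'] [Hc Hc']. eapply assignment_eq; try eassumption.
  intros k x Hk. rewrite Hb', Hc'; tauto.
Qed.

(** ** Matching Tarski models with T/F-models *)

Lemma formula_eql C P ar s t w :
  is_term C s -> is_term C t -> code_eq 0 s t w -> is_formula C P ar w.
Proof. intros Hs Ht Hw X [H _]. eauto. Qed.

Lemma formula_rel C P ar R ts w :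
  is_arguments C P ar R ts -> code_eq 1 R ts w -> is_formula C P ar w.
Proof. intros HR Hw X [_ [H _]]. eauto. Qed.

Lemma formula_bot C P ar w : bot_eq w -> is_formula C P ar w.
Proof. intros Hw X [_ [_ [H _]]]. eauto. Qed.

Lemma formula_neg C P ar p w : is_formula C P ar p -> code_eq 3 p p w -> is_formula C P ar w.
Proof. intros Hp Hw X HX. specialize (Hp X HX). destruct HX as [_ [_ [_ [H _]]]]. eauto. Qed.

Lemma formula_binary C P ar p q w : is_formula C P ar p -> is_formula C P ar q ->
  code_eq 4 p q w \/ code_eq 5 p q w \/ code_eq 6 p q w -> is_formula C P ar w.
Proof.
  intros Hp Hq Hw X HX. specialize (Hp X HX). specialize (Hq X HX).
  destruct HX as [_ [_ [_ [_ [H _]]]]]. eauto.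
Qed.

Lemma formula_quantifier C P ar n p w : in_omega n -> is_formula C P ar p ->
  code_eq 7 n p w \/ code_eq 8 n p w -> is_formula C P ar w.
Proof.
  intros Hn Hp Hw X HX. specialize (Hp X HX).
  destruct HX as [_ [_ [_ [_ [_ H]]]]]. eauto.
Qed.

(** * A Tarski model and a T/F-model linked by a bijection of domains *)

Section Correspondence.

Variables C P ar M1 c1 r M2 c2 rp rn ep en h : V.

(** Says g = h∘f for [f] into [M1] and [g] into [M2]; used for constants, assignments and argument
    tuples alike. *)
Definition carries (f g : V) : Prop :=
  forall k x y, pair_in x y h -> (pair_in k x f <-> pair_in k y g).

Hypothesis M1_crisp : crisp M1.
Hypothesis M2_crisp : crisp M2.
Hypothesis h_maps : maps h M1 M2.
Hypothesis h_injective : forall x x' y, pair_in x y h -> pair_in x' y h -> x = x'.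
Hypothesis h_surjective : forall y, y ∈+ M2 -> exists x, pair_in x y h.
Hypothesis c1_maps : maps c1 C M1.
Hypothesis c2_maps : maps c2 C M2.
Hypothesis c_carries : carries c1 c2.
(** Together with [rel_matches], the whole demand on atomic facts: what is true on the Tarski side
    corresponds to the + relation, what is false to the - relation. *)
Hypothesis eql_matches : forall x x' y y', pair_in x x' h -> pair_in y y' h ->
  (pair_in x' y' ep <-> x = y) /\ (pair_in x' y' en <-> eql_neg V x y).
Hypothesis r_total : forall R, R ∈+ P -> exists i, pair_in R i r.
Hypothesis rp_total : forall R, R ∈+ P -> exists i, pair_in R i rp.
Hypothesis rn_total : forall R, R ∈+ P -> exists i, pair_in R i rn.
Hypothesis rel_matches : forall R n i ip jn b1 b2,
  pair_in R n ar -> pair_in R i r -> pair_in R ip rp -> pair_in R jn rn ->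
  maps b1 n M1 -> maps b2 n M2 -> carries b1 b2 ->
  (b1 ∈+ i <-> b2 ∈+ ip) /\ (b1 ∈- i <-> b2 ∈+ jn).

Lemma h_total x : x ∈+ M1 -> exists y, y ∈+ M2 /\ pair_in x y h.
Proof.
  intros Hx. destruct (maps_total _ _ _ _ h_maps Hx) as [y Hy]. exists y.
  split; [eauto using maps_dom, maps_cod|exact Hy].
Qed.

Lemma h_onto y : y ∈+ M2 -> exists x, x ∈+ M1 /\ pair_in x y h.
Proof.
  intros Hy. destruct (h_surjective y Hy) as [x Hx]. exists x.
  split; [eauto using maps_dom, maps_cod|exact Hx].
Qed.

Lemma h_functional x y y' : pair_in x y h -> pair_in x y' h -> y = y'.
Proof. eapply maps_functional, h_maps. Qed.

Lemma carry_forth f A : maps f A M1 -> exists g, maps g A M2 /\ carries f g.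
Proof.
  intros Hf.
  edestruct (function_exists (push (push (world0 f) f) h))
    with (R := fun k y => exists x, pair_in k x f /\ pair_in x y h) (A := A) (B := M2)
    as [g [Hg Hin]].
  - intros. define.
  - apply Hf.
  - exact M2_crisp.
  - intros k Hk. destruct (maps_total _ _ _ _ Hf Hk) as [x Hx].
    destruct (h_total x) as [y [Hy Hxy]]; [eauto using maps_dom, maps_cod|].
    exists y. split; [exact Hy|]. split; [eauto|]. intros z [x' [Hx' Hz]].
    rewrite (maps_functional _ _ _ _ _ _ Hf Hx' Hx) in Hz. eapply h_functional; eassumption.
  - exists g. split; [exact Hg|]. intros k x y Hxy. rewrite Hin. split.
    + intros Hk. split; [eauto using maps_dom, maps_cod|eauto].
    + intros [_ [x' [Hx' Hy]]]. now rewrite (h_injective _ _ _ Hxy Hy).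
Qed.

Lemma carry_back g A : maps g A M2 -> exists f, maps f A M1 /\ carries f g.
Proof.
  intros Hg.
  edestruct (function_exists (push (push (world0 g) g) h))
    with (R := fun k x => exists y, pair_in k y g /\ pair_in x y h) (A := A) (B := M1)
    as [f [Hf Hin]].
  - intros. define.
  - apply Hg.
  - exact M1_crisp.
  - intros k Hk. destruct (maps_total _ _ _ _ Hg Hk) as [y Hy].
    destruct (h_onto y) as [x [Hx Hxy]]; [eauto using maps_dom, maps_cod|].
    exists x. split; [exact Hx|]. split; [eauto|]. intros z [y' [Hy' Hz]].
    rewrite (maps_functional _ _ _ _ _ _ Hg Hy' Hy) in Hz. eapply h_injective; eassumption.
  - exists f. split; [exact Hf|]. intros k x y Hxy. rewrite Hin. split.
    + intros [_ [y' [Hy' Hy]]]. now rewrite (h_functional _ _ _ Hxy Hy).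
    + intros Hk. split; [eauto using maps_dom, maps_cod|eauto].
Qed.

Lemma carries_unique_r f A g B g' B' : maps f A M1 -> maps g B M2 -> maps g' B' M2 ->
  carries f g -> carries f g' -> g = g'.
Proof.
  intros Hf Hg Hg' H H'. eapply maps_eq; try eassumption. intros k y. split; intros Hk.
  - destruct (h_onto y) as [x [_ Hx]]; [eauto using maps_dom, maps_cod|].
    now apply (H' k x y Hx), (H k x y Hx).
  - destruct (h_onto y) as [x [_ Hx]]; [eauto using maps_dom, maps_cod|].
    now apply (H k x y Hx), (H' k x y Hx).
Qed.

Lemma carries_unique_l f A f' A' g B : maps f A M1 -> maps f' A' M1 -> maps g B M2 ->
  carries f g -> carries f' g -> f = f'.
Proof.
  intros Hf Hf' Hg H H'. eapply maps_eq; try eassumption. intros k x. split; intros Hk.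
  - destruct (h_total x) as [y [_ Hy]]; [eauto using maps_dom, maps_cod|].
    now apply (H' k x y Hy), (H k x y Hy).
  - destruct (h_total x) as [y [_ Hy]]; [eauto using maps_dom, maps_cod|].
    now apply (H k x y Hy), (H' k x y Hy).
Qed.

Definition carried (a1 a2 : V) : Prop :=
  is_assignment M1 a1 /\ is_assignment M2 a2 /\ carries a1 a2.

Lemma assignment_forth a1 : is_assignment M1 a1 -> exists a2, carried a1 a2.
Proof.
  intros [w [Hw Ha]]. destruct (carry_forth _ _ Ha) as [a2 [H K]].
  exists a2. split; [now exists w|]. split; [now exists w|exact K].
Qed.

Lemma assignment_back a2 : is_assignment M2 a2 -> exists a1, carried a1 a2.
Proof.
  intros [w [Hw Ha]]. destruct (carry_back _ _ Ha) as [a1 [H K]].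
  exists a1. split; [now exists w|]. split; [now exists w|exact K].
Qed.

Lemma carried_unique_r a b b' : carried a b -> carried a b' -> b = b'.
Proof.
  intros [[w [_ Ha]] [[w1 [_ Hb]] H]] [_ [[w2 [_ Hb']] H']].
  exact (carries_unique_r _ _ _ _ _ _ Ha Hb Hb' H H').
Qed.

Lemma carried_unique_l a a' b : carried a b -> carried a' b -> a = a'.
Proof.
  intros [[w [_ Ha]] [[w1 [_ Hb]] H]] [[w2 [_ Ha']] [_ H']].
  exact (carries_unique_l _ _ _ _ _ _ Ha Ha' Hb H H').
Qed.

Lemma carried_update a1 a2 n m1 m2 b1 b2 : carried a1 a2 -> pair_in m1 m2 h ->
  update_eq M1 a1 n m1 b1 -> update_eq M2 a2 n m2 b2 -> carried b1 b2.
Proof.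
  intros [_ [_ Ha]] Hm [Hb1 H1] [Hb2 H2]. split; [exact Hb1|]. split; [exact Hb2|].
  intros k x y Hxy. destruct (classic (in_omega k)) as [Hk|Hk].
  - rewrite H1, H2, (Ha k x y Hxy) by exact Hk.
    assert (x = m1 <-> y = m2).
    { split; intros ->; [eapply h_functional|eapply h_injective]; eassumption. }
    tauto.
  - split; intros K; elim Hk; eapply assignment_pair; try apply K; eassumption.
Qed.

Lemma value_carried a1 a2 t x y : carried a1 a2 -> pair_in x y h ->
  (value_eq c1 a1 t x <-> value_eq c2 a2 t y).
Proof.
  intros [_ [_ Ha]] Hxy. unfold value_eq.
  assert (E1 := fun k => Ha k x y Hxy). assert (E2 := fun k => c_carries k x y Hxy).
  split; intros [[k K]|[k K]]; [left|right|left|right]; exists k;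
    specialize (E1 k); specialize (E2 k); tauto.
Qed.

Lemma value_forth a1 a2 t x : carried a1 a2 -> value_eq c1 a1 t x ->
  exists y, pair_in x y h /\ value_eq c2 a2 t y.
Proof.
  intros Ha Hx. assert (Hx1 : x ∈+ M1).
  { destruct Hx as [[k [_ [_ K]]]|[k [_ K]]].
    - eapply assignment_pair; [apply Ha|exact K].
    - eauto using maps_dom, maps_cod. }
  destruct (h_total x Hx1) as [y [_ Hy]]. exists y. split; [exact Hy|].
  now apply (value_carried a1 a2 t x y).
Qed.

Lemma value_back a1 a2 t y : carried a1 a2 -> value_eq c2 a2 t y ->
  exists x, pair_in x y h /\ value_eq c1 a1 t x.
Proof.
  intros Ha Hy. assert (Hy1 : y ∈+ M2).
  { destruct Hy as [[k [_ [_ K]]]|[k [_ K]]].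
    - eapply assignment_pair; [apply Ha|exact K].
    - eauto using maps_dom, maps_cod. }
  destruct (h_onto y Hy1) as [x [_ Hx]]. exists x. split; [exact Hx|].
  now apply (value_carried a1 a2 t x y).
Qed.

Lemma values_forth a1 a2 R ts b1 : carried a1 a2 -> values_eq M1 ar c1 a1 R ts b1 ->
  exists b2 n, values_eq M2 ar c2 a2 R ts b2 /\
    pair_in R n ar /\ maps b1 n M1 /\ maps b2 n M2 /\ carries b1 b2.
Proof.
  intros Ha [n [Hn [Hb H]]]. destruct (carry_forth _ _ Hb) as [b2 [Hb2 K]].
  exists b2, n. split; [|tauto]. exists n. split; [exact Hn|]. split; [exact Hb2|].
  intros i t y Ht Hy. destruct (h_onto y) as [x [_ Hx]]; [eauto using maps_dom, maps_cod|].
  apply (value_carried a1 a2 t x y Ha Hx). eapply H; [exact Ht|]. now apply (K i x y).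
Qed.

Lemma values_back a1 a2 R ts b2 : carried a1 a2 -> values_eq M2 ar c2 a2 R ts b2 ->
  exists b1 n, values_eq M1 ar c1 a1 R ts b1 /\
    pair_in R n ar /\ maps b1 n M1 /\ maps b2 n M2 /\ carries b1 b2.
Proof.
  intros Ha [n [Hn [Hb H]]]. destruct (carry_back _ _ Hb) as [b1 [Hb1 K]].
  exists b1, n. split; [|tauto]. exists n. split; [exact Hn|]. split; [exact Hb1|].
  intros i t x Ht Hx. destruct (h_total x) as [y [_ Hy]]; [eauto using maps_dom, maps_cod|].
  apply (value_carried a1 a2 t x y Ha Hy). eapply H; [exact Ht|]. now apply (K i x y).
Qed.

(** * Quantifiers along the bijection *)

Section Quantifiers.

Variables (a1 a2 n : V) (X Y : V -> Prop).
Hypothesis Ha : carried a1 a2.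
Hypothesis Hn : in_omega n.
Hypothesis HXY : forall b1 b2, carried b1 b2 -> (X b1 <-> Y b2).

Lemma some_update_carried m1 m2 : pair_in m1 m2 h ->
  ((exists b, update_eq M1 a1 n m1 b /\ X b) <-> (exists b, update_eq M2 a2 n m2 b /\ Y b)).
Proof.
  intros Hm.
  destruct (maps_pair _ _ _ _ _ h_maps Hm) as [Hm1 Hm2].
  destruct (update_exists M1 a1 n m1) as [b1 Hb1]; trivial; [apply Ha|].
  destruct (update_exists M2 a2 n m2) as [b2 Hb2]; trivial; [apply Ha|].
  assert (E := HXY b1 b2 (carried_update _ _ _ _ _ _ _ Ha Hm Hb1 Hb2)).
  split; intros [b [Hb K]].
  - rewrite (update_unique _ _ _ _ _ _ Hb Hb1) in K. exists b2. tauto.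
  - rewrite (update_unique _ _ _ _ _ _ Hb Hb2) in K. exists b1. tauto.
Qed.

(** An update exists and is unique, so the universal form in the Tarski falsity clauses agrees with
    the existential form in the T/F clauses. *)
Lemma every_update m : m ∈+ M1 ->
  ((forall b, update_eq M1 a1 n m b -> X b) <-> (exists b, update_eq M1 a1 n m b /\ X b)).
Proof.
  intros Hm. destruct (update_exists M1 a1 n m) as [b Hb]; trivial; [apply Ha|].
  split.
  - intros K. exists b. auto.
  - intros [b' [Hb' K]] b'' Hb''. now rewrite (update_unique _ _ _ _ _ _ Hb'' Hb').
Qed.

Lemma exists_carried :
  (exists m, m ∈+ M1 /\ exists b, update_eq M1 a1 n m b /\ X b) <->
  (exists m, m ∈+ M2 /\ exists b, update_eq M2 a2 n m b /\ Y b).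
Proof.
  split; intros [m [Hm K]].
  - destruct (h_total m Hm) as [m' [Hm' H]]. exists m'. split; [exact Hm'|].
    now apply (some_update_carried m m').
  - destruct (h_onto m Hm) as [m' [Hm' H]]. exists m'. split; [exact Hm'|].
    now apply (some_update_carried m' m).
Qed.

Lemma forall_carried :
  (forall m, m ∈+ M1 -> exists b, update_eq M1 a1 n m b /\ X b) <->
  (forall m, m ∈+ M2 -> exists b, update_eq M2 a2 n m b /\ Y b).
Proof.
  split; intros K m Hm.
  - destruct (h_onto m Hm) as [m' [Hm' H]]. apply (some_update_carried m' m H); auto.
  - destruct (h_total m Hm) as [m' [Hm' H]]. apply (some_update_carried m m' H); auto.
Qed.

Lemma exists_every_carried :
  (exists m, m ∈+ M1 /\ forall b, update_eq M1 a1 n m b -> X b) <->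
  (exists m, m ∈+ M2 /\ exists b, update_eq M2 a2 n m b /\ Y b).
Proof.
  rewrite <- exists_carried.
  split; intros [m [Hm K]]; exists m; (split; [exact Hm|]); now apply every_update.
Qed.

(** The left side is the falsity condition of an existential formula; crispness of [M1] turns its
    disjunction into a bounded quantifier. *)
Lemma forall_every_carried :
  (forall m, m ∈- M1 \/ forall b, update_eq M1 a1 n m b -> X b) <->
  (forall m, m ∈+ M2 -> exists b, update_eq M2 a2 n m b /\ Y b).
Proof.
  rewrite <- forall_carried. split.
  - intros K m Hm. apply every_update; trivial. destruct (K m) as [J|J]; trivial.
    now apply M1_crisp in Hm.
  - intros K m. destruct (classic (m ∈- M1)) as [J|J]; [tauto|right].
    assert (Hm : m ∈+ M1) by now apply M1_crisp. apply every_update; auto.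
Qed.

End Quantifiers.

(** * Transfer of satisfaction relations *)

Definition agree (Sat T F : V) : Prop :=
  forall w a1 a2, is_formula C P ar w -> carried a1 a2 ->
    (pair_in w a1 Sat <-> pair_in w a2 T) /\ (pair_notin w a1 Sat <-> pair_in w a2 F).

(** Each clause mentions a formula and at most its immediate parts, all of them formulas, so [agree]
    translates every occurrence and no induction is involved. *)
Lemma tarski_clauses_imp_tf_clauses Sat T F : agree Sat T F -> crisp T -> crisp F ->
  satisfies_tarski_clauses C P ar M1 c1 r Sat ->
  satisfies_tf_clauses C P ar M2 c2 rp rn ep en T F.
Proof.
  intros HA HT HF [Heql [Hrel [Hbot [Hneg [Hbin Hquant]]]]].
  split; [exact HT|]. split; [exact HF|]. repeat apply conj.
  - intros s t w a x y Hs Ht Hw Ha Hx Hy.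
    destruct (assignment_back a Ha) as [a1 K].
    destruct (value_back _ _ _ _ K Hx) as [x1 [Hxx Hx1]].
    destruct (value_back _ _ _ _ K Hy) as [y1 [Hyy Hy1]].
    destruct (Heql s t w a1 x1 y1 Hs Ht Hw (proj1 K) Hx1 Hy1).
    destruct (HA w a1 a (formula_eql _ _ _ _ _ _ Hs Ht Hw) K).
    destruct (eql_matches _ _ _ _ Hxx Hyy). tauto.
  - intros R ts w a i j b HR Hw Ha Hi Hj Hb.
    destruct (assignment_back a Ha) as [a1 K].
    destruct (values_back _ _ _ _ _ K Hb) as [b1 [n [Hb1 [Hn [Hm1 [Hm2 Hc]]]]]].
    destruct (r_total R (proj1 HR)) as [i1 Hi1].
    destruct (Hrel R ts w a1 i1 b1 HR Hw (proj1 K) Hi1 Hb1).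
    destruct (HA w a1 a (formula_rel _ _ _ _ _ _ HR Hw) K).
    destruct (rel_matches _ _ _ _ _ _ _ Hn Hi1 Hi Hj Hm1 Hm2 Hc). tauto.
  - intros w a Hw Ha. destruct (assignment_back a Ha) as [a1 K].
    destruct (Hbot w a1 Hw (proj1 K)), (HA w a1 a (formula_bot _ _ _ _ Hw) K). tauto.
  - intros p w a Hp Hw Ha. destruct (assignment_back a Ha) as [a1 K].
    destruct (Hneg p w a1 Hp Hw (proj1 K)), (HA p a1 a Hp K),
      (HA w a1 a (formula_neg _ _ _ _ _ Hp Hw) K). tauto.
  - intros p q w a Hp Hq Ha. destruct (assignment_back a Ha) as [a1 K].
    destruct (Hbin p q w a1 Hp Hq (proj1 K)) as [H1 [H2 H3]].
    assert (Ew := fun H => HA w a1 a (formula_binary _ _ _ _ _ _ Hp Hq H) K).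
    destruct (HA p a1 a Hp K) as [E1 E2], (HA q a1 a Hq K) as [E3 E4].
    rewrite E1, E2, E3, E4 in H1, H2. rewrite E1, E3, E4 in H3.
    split; [|split]; intros Hw.
    + destruct (Ew (or_introl Hw)) as [<- <-]; auto.
    + destruct (Ew (or_intror (or_introl Hw))) as [<- <-]; auto.
    + destruct (Ew (or_intror (or_intror Hw))) as [<- <-]; auto.
  - intros n p w a Hn Hp Ha. destruct (assignment_back a Ha) as [a1 K].
    destruct (Hquant n p w a1 Hn Hp (proj1 K)) as [H1 H2].
    assert (Ew := fun H => HA w a1 a (formula_quantifier _ _ _ _ _ _ Hn Hp H) K).
    assert (ET := fun b1 b2 H => proj1 (HA p b1 b2 Hp H)).
    assert (EF := fun b1 b2 H => proj2 (HA p b1 b2 Hp H)).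
    rewrite <- (exists_carried _ _ _ _ _ K Hn ET), <- (forall_carried _ _ _ _ _ K Hn ET),
      <- (forall_every_carried _ _ _ _ _ K Hn EF), <- (exists_every_carried _ _ _ _ _ K Hn EF).
    split; intros Hw.
    + destruct (Ew (or_intror Hw)) as [<- <-]; auto.
    + destruct (Ew (or_introl Hw)) as [<- <-]; auto.
Qed.

Lemma tf_clauses_imp_tarski_clauses Sat T F : agree Sat T F ->
  satisfies_tf_clauses C P ar M2 c2 rp rn ep en T F ->
  satisfies_tarski_clauses C P ar M1 c1 r Sat.
Proof.
  intros HA [_ [_ [Heql [Hrel [Hbot [Hneg [Hbin Hquant]]]]]]]. repeat apply conj.
  - intros s t w a x y Hs Ht Hw Ha Hx Hy.
    destruct (assignment_forth a Ha) as [a2 K].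
    destruct (value_forth _ _ _ _ K Hx) as [x2 [Hxx Hx2]].
    destruct (value_forth _ _ _ _ K Hy) as [y2 [Hyy Hy2]].
    destruct (Heql s t w a2 x2 y2 Hs Ht Hw (proj1 (proj2 K)) Hx2 Hy2).
    destruct (HA w a a2 (formula_eql _ _ _ _ _ _ Hs Ht Hw) K).
    destruct (eql_matches _ _ _ _ Hxx Hyy). tauto.
  - intros R ts w a i b HR Hw Ha Hi Hb.
    destruct (assignment_forth a Ha) as [a2 K].
    destruct (values_forth _ _ _ _ _ K Hb) as [b2 [n [Hb2 [Hn [Hm1 [Hm2 Hc]]]]]].
    destruct (rp_total R (proj1 HR)) as [ip Hip], (rn_total R (proj1 HR)) as [jn Hjn].
    destruct (Hrel R ts w a2 ip jn b2 HR Hw (proj1 (proj2 K)) Hip Hjn Hb2).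
    destruct (HA w a a2 (formula_rel _ _ _ _ _ _ HR Hw) K).
    destruct (rel_matches _ _ _ _ _ _ _ Hn Hi Hip Hjn Hm1 Hm2 Hc). tauto.
  - intros w a Hw Ha. destruct (assignment_forth a Ha) as [a2 K].
    destruct (Hbot w a2 Hw (proj1 (proj2 K))), (HA w a a2 (formula_bot _ _ _ _ Hw) K). tauto.
  - intros p w a Hp Hw Ha. destruct (assignment_forth a Ha) as [a2 K].
    destruct (Hneg p w a2 Hp Hw (proj1 (proj2 K))), (HA p a a2 Hp K),
      (HA w a a2 (formula_neg _ _ _ _ _ Hp Hw) K). tauto.
  - intros p q w a Hp Hq Ha. destruct (assignment_forth a Ha) as [a2 K].
    destruct (Hbin p q w a2 Hp Hq (proj1 (proj2 K))) as [H1 [H2 H3]].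
    assert (Ew := fun H => HA w a a2 (formula_binary _ _ _ _ _ _ Hp Hq H) K).
    destruct (HA p a a2 Hp K) as [E1 E2], (HA q a a2 Hq K) as [E3 E4].
    rewrite <- E1, <- E2, <- E3, <- E4 in H1, H2. rewrite <- E1, <- E3, <- E4 in H3.
    split; [|split]; intros Hw.
    + destruct (Ew (or_introl Hw)) as [-> ->]; auto.
    + destruct (Ew (or_intror (or_introl Hw))) as [-> ->]; auto.
    + destruct (Ew (or_intror (or_intror Hw))) as [-> ->]; auto.
  - intros n p w a Hn Hp Ha. destruct (assignment_forth a Ha) as [a2 K].
    destruct (Hquant n p w a2 Hn Hp (proj1 (proj2 K))) as [H1 H2].
    assert (Ew := fun H => HA w a a2 (formula_quantifier _ _ _ _ _ _ Hn Hp H) K).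
    assert (ET := fun b1 b2 H => proj1 (HA p b1 b2 Hp H)).
    assert (EF := fun b1 b2 H => proj2 (HA p b1 b2 Hp H)).
    rewrite (exists_carried _ _ _ _ _ K Hn ET), (forall_carried _ _ _ _ _ K Hn ET),
      (forall_every_carried _ _ _ _ _ K Hn EF), (exists_every_carried _ _ _ _ _ K Hn EF).
    split; intros Hw.
    + destruct (Ew (or_intror Hw)) as [-> ->]; auto.
    + destruct (Ew (or_introl Hw)) as [-> ->]; auto.
Qed.

(** Replacement collects images of positive members, so [F] is gathered from the true negations; the
    clause for ∼ identifies these with the falsities. *)
Lemma agreeing_tf Sat : satisfies_tarski_clauses C P ar M1 c1 r Sat ->
  exists T F, agree Sat T F /\ crisp T /\ crisp F.
Proof.
  intros HS.
  edestruct (image (push (push (push (world0 h) h) M1) M2)) with (u := Sat)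
    (R := fun q z => exists w a1 a2, opair_eq w a1 q /\ opair_eq w a2 z /\ carried a1 a2)
    as [T HT].
  { intros. unfold carried, carries. define. }
  { intros q y z _ [w [a1 [a2 [Hq [Hy H]]]]] [w' [a1' [a2' [Hq' [Hz H']]]]].
    destruct (opair_inj _ _ _ _ _ Hq Hq') as [<- <-].
    rewrite (carried_unique_r _ _ _ H H') in Hy. eapply opair_unique; eassumption. }
  edestruct (image (push (push (push (world0 h) h) M1) M2)) with (u := Sat)
    (R := fun q z => exists w nw a1 a2, code_eq 3 w w nw /\ opair_eq nw a1 q /\
       opair_eq w a2 z /\ carried a1 a2)
    as [F HF].
  { intros. unfold carried, carries. define. }
  { intros q y z _ [w [nw [a1 [a2 [Hw [Hq [Hy H]]]]]]] [w' [nw' [a1' [a2' [Hw' [Hq' [Hz H']]]]]]].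
    destruct (opair_inj _ _ _ _ _ Hq Hq') as [<- <-].
    destruct (code_inj _ _ _ _ _ _ Hw Hw') as [<- _].
    rewrite (carried_unique_r _ _ _ H H') in Hy. eapply opair_unique; eassumption. }
  exists T, F. split; [|split; eapply class_crisp; eassumption].
  intros w a1 a2 Hw Ha. destruct (opair_exists w a2) as [z Hz].
  rewrite (pair_in_iff _ _ _ _ Hz), (proj1 (HT z)), (pair_in_iff _ _ _ _ Hz), (proj1 (HF z)).
  split; split.
  - intros [q [Hq Hq']]. exists q. split; [exact Hq'|]. exists w, a1, a2. auto.
  - intros [q [Hq [w' [a1' [a2' [Hq' [Hz' Ha']]]]]]].
    destruct (opair_inj _ _ _ _ _ Hz Hz') as [<- <-].
    rewrite (carried_unique_l _ _ _ Ha Ha'). now exists q.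
  - intros H. destruct (code_exists 3 w w) as [nw Hnw].
    destruct HS as [_ [_ [_ [Hneg _]]]].
    apply (Hneg w nw a1 Hw Hnw (proj1 Ha)) in H. destruct H as [q [Hq Hq']].
    exists q. split; [exact Hq'|]. exists w, nw, a1, a2. auto.
  - intros [q [Hq [w' [nw [a1' [a2' [Hnw [Hq' [Hz' Ha']]]]]]]]].
    destruct (opair_inj _ _ _ _ _ Hz Hz') as [<- <-].
    rewrite <- (carried_unique_l _ _ _ Ha Ha') in Hq'.
    destruct HS as [_ [_ [_ [Hneg _]]]].
    apply (Hneg w nw a1 Hw Hnw (proj1 Ha)). now exists q.
Qed.

(* [(w, a)] is not in [F] iff the implication [∼w → ⊥] is true at [a], so the
   pairs outside [F] are bounded by a set although the class of formulas need not be. *)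
Lemma agreeing_sat T F : satisfies_tf_clauses C P ar M2 c2 rp rn ep en T F ->
  exists Sat, agree Sat T F.
Proof.
  intros [_ [_ [_ [_ [Hbot [Hneg [Hbin _]]]]]]].
  edestruct (image (push (push (push (world0 h) h) M1) M2)) with (u := T)
    (R := fun q z => exists w a1 a2, opair_eq w a2 q /\ opair_eq w a1 z /\ carried a1 a2)
    as [u Hu].
  { intros. unfold carried, carries. define. }
  { intros q y z _ [w [a1 [a2 [Hq [Hy H]]]]] [w' [a1' [a2' [Hq' [Hz H']]]]].
    destruct (opair_inj _ _ _ _ _ Hq Hq') as [<- <-].
    rewrite (carried_unique_l _ _ _ H H') in Hy. eapply opair_unique; eassumption. }
  edestruct (image (push (push (push (world0 h) h) M1) M2)) with (u := T)
    (R := fun q z => exists w nw b w' a1 a2, code_eq 3 w w nw /\ bot_eq b /\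
       code_eq 6 nw b w' /\ opair_eq w' a2 q /\ opair_eq w a1 z /\ carried a1 a2)
    as [v Hv].
  { intros. unfold carried, carries. define. }
  { intros q y z _ [w [nw [b [w' [a1 [a2 [Hnw [Hb [Hw' [Hq [Hy H]]]]]]]]]]]
      [x [nx [d [x' [a1' [a2' [Hnx [Hd [Hx' [Hq' [Hz H']]]]]]]]]]].
    destruct (opair_inj _ _ _ _ _ Hq Hq') as [<- <-].
    destruct (code_inj _ _ _ _ _ _ Hw' Hx') as [<- <-].
    destruct (code_inj _ _ _ _ _ _ Hnw Hnx) as [<- _].
    rewrite (carried_unique_l _ _ _ H H') in Hy. eapply opair_unique; eassumption. }
  destruct (union_bound u v) as [s Hs].
  edestruct (mk_set (push (push (world0 u) u) v)) with (u := s)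
    (P := fun z => z ∈+ u) (Q := fun z => ~ z ∈+ v) as [Sat HSat].
  { intros. define. }
  { intros. define. }
  { intros z [H|H]; apply Hs; [now left|right; now apply NNPP]. }
  exists Sat. intros w a1 a2 Hw Ha. destruct (opair_exists w a1) as [z Hz].
  rewrite (pair_in_iff _ _ _ _ Hz), (pair_notin_iff _ _ _ _ Hz).
  destruct (HSat z) as [-> ->]. rewrite (proj1 (Hu z)), (proj1 (Hv z)). split.
  - split.
    + intros [q [Hq [w' [a1' [a2' [Hq' [Hz' Ha']]]]]]].
      destruct (opair_inj _ _ _ _ _ Hz Hz') as [<- <-].
      rewrite (carried_unique_r _ _ _ Ha Ha'). now exists q.
    + intros [q [Hq Hq']]. exists q. split; [exact Hq'|]. exists w, a1, a2. auto.
  - destruct (code_exists 3 w w) as [nw Hnw], empty_exists as [e He],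
      (code_exists 2 e e) as [b Hb'], (code_exists 6 nw b) as [w' Hw'].
    assert (Hb : bot_eq b) by now exists e.
    assert (Hfn := formula_neg _ _ _ _ _ Hw Hnw). assert (Hfb := formula_bot C P ar b Hb).
    assert (Ha2 := proj1 (proj2 Ha)).
    transitivity (~ pair_in w' a2 T).
    + apply not_iff_compat. split.
      * intros [q [Hq [x [nx [d [x' [a1' [a2' [Hnx [Hd [Hx' [Hq' [Hz' Ha']]]]]]]]]]]]].
        destruct (opair_inj _ _ _ _ _ Hz Hz') as [<- <-].
        rewrite (carried_unique_r _ _ _ Ha Ha').
        rewrite (code_unique _ _ _ _ _ Hnw Hnx) in Hw'.
        assert (b = d).
        { destruct Hd as [e' [He' Hd]]. rewrite (eq_classes _ _ _ He' He) in Hd.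
          eapply code_unique; eassumption. }
        subst d. rewrite (code_unique _ _ _ _ _ Hw' Hx'). now exists q.
      * intros [q [Hq Hq']]. exists q. split; [exact Hq'|].
        exists w, nw, b, w', a1, a2. repeat (split; [assumption|]). exact Ha.
    + destruct (Hbin nw b w' a2 Hfn Hfb Ha2) as [_ [_ H]].
      rewrite (proj1 (H Hw')).
      destruct (Hneg w nw a2 Hw Hnw Ha2) as [-> _], (Hbot b a2 Hb Ha2).
      destruct (classic (pair_in w a2 F)); tauto.
Qed.

Lemma satisfied_iff_tf_satisfied phi a1 a2 : is_formula C P ar phi -> carried a1 a2 ->
  (satisfied C P ar M1 c1 r phi a1 <-> tf_satisfied C P ar M2 c2 rp rn ep en phi a2).
Proof.
  intros Hphi Ha. split.
  - intros [Sat [HS H]]. destruct (agreeing_tf Sat HS) as [T [F [HA [HT HF]]]].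
    exists T, F. split; [eapply tarski_clauses_imp_tf_clauses; eassumption|].
    now apply (HA phi a1 a2).
  - intros [T [F [HTF H]]]. destruct (agreeing_sat T F HTF) as [Sat HA].
    exists Sat. split; [eapply tf_clauses_imp_tarski_clauses; eassumption|].
    now apply (HA phi a1 a2).
Qed.

End Correspondence.

(** * Conversion of models and equality of the consequence relations *)

Section Adequacy.

Variables C P ar omega_set : V.
Hypothesis C_crisp : crisp C.
Hypothesis P_crisp : crisp P.
Hypothesis ar_maps : maps ar P omega_set.

(** The exact shape of the conditions on [ep] and [en] in [is_tf_model]: a crisp set strongly
    included in M×M. *)
Definition is_relation_on (e M : V) : Prop :=
  crisp e /\ forall z,
    (z ∈+ e -> exists a b, opair_eq a b z /\ a ∈+ M /\ b ∈+ M) /\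
    ((forall a b, ~ opair_eq a b z \/ a ∈- M \/ b ∈- M) -> z ∈- e).

Lemma relation_exists w G (R : V -> V -> Prop) M :
  (forall w' x y a b, ext w w' -> denotes w' x a -> denotes w' y b ->
     truth w' (G x y) (R a b)) ->
  crisp M ->
  exists e, is_relation_on e M /\
    forall a b, pair_in a b e <-> a ∈+ M /\ b ∈+ M /\ R a b.
Proof.
  intros HG HM. destruct (product_bound M M) as [u Hu].
  edestruct (mk_class (push w M))
    with (P := fun z => exists a b, a ∈+ M /\ b ∈+ M /\ R a b /\ opair_eq a b z) (u := u)
    as [e He].
  - intros w' z c E Hz.
    (* [G] will stand under two quantifiers; a hypothesis across two extensions spares the search
       the transitivity of [ext]. *)
    assert (forall w1 w2 x y a b, ext w' w1 -> ext w1 w2 -> denotes w2 x a -> denotes w2 y b ->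
      truth w2 (G x y) (R a b)) by eauto using ext_trans, ext_push.
    define.
  - intros z [a [b [Ha [Hb [_ Hz]]]]]. eauto.
  - exists e. split; [split; [eapply class_crisp, He|]|].
    + intros z. split.
      * intros Hz. apply He in Hz. destruct Hz as [a [b [Ha [Hb [_ Hz]]]]]. exists a, b. auto.
      * intros K. apply He. intros [a [b [Ha [Hb [_ Hz]]]]].
        apply HM in Ha, Hb. destruct (K a b) as [?|[?|?]]; tauto.
    + intros a b. destruct (opair_exists a b) as [p Hp].
      rewrite (pair_in_iff _ _ _ _ Hp), (proj1 (He p)). split.
      * intros [a' [b' [Ha [Hb [HR Hp']]]]].
        destruct (opair_inj _ _ _ _ _ Hp Hp') as [-> ->]. auto.
      * intros [Ha [Hb HR]]. exists a, b. auto.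
Qed.

Lemma arity R : R ∈+ P -> exists n, pair_in R n ar.
Proof. eapply maps_total, ar_maps. Qed.

Lemma arity_unique R n m : pair_in R n ar -> pair_in R m ar -> n = m.
Proof. eapply maps_functional, ar_maps. Qed.

Lemma tf_model_of_tarski_model M c r : is_tarski_model C P ar M c r ->
  exists rp rn ep en, is_tf_model C P ar M c rp rn ep en /\
    forall phi a, is_formula C P ar phi -> is_assignment M a ->
      (satisfied C P ar M c r phi a <-> tf_satisfied C P ar M c rp rn ep en phi a).
Proof.
  intros [[HM Hne] [Hc [[B Hr] Hval]]].
  (* The domain is kept, so the linking bijection is the identity on [M]. *)
  edestruct (function_exists (world0 M)) with (R := fun x y : V => x = y) (A := M) (B := M)
    as [h [Hh Hid]]; [intros; define|exact HM|exact HM| |].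
  { intros x Hx. exists x. auto. }
  edestruct (function_from_exists (push (world0 r) r))
    with (R := fun R ip => exists i, pair_in R i r /\ is_class ip (fun b => b ∈+ i)) (A := P)
    as [rp [Bp [Hrp [_ Hrp']]]]; [intros; define|exact P_crisp| |].
  { intros R HR. destruct (maps_total _ _ _ _ Hr HR) as [i Hi].
    edestruct (mk_class (push (world0 i) i)) with (P := fun b => b ∈+ i) (u := i) as [ip Hip];
      [intros; define|trivial|].
    exists ip. split; [eauto|]. intros j [i' [Hi' Hj]].
    rewrite (maps_functional _ _ _ _ _ _ Hr Hi' Hi) in Hj. eapply eq_classes; eassumption. }
  (* All objects outside Mⁿ are non-members of r(R); R⁻ keeps only the non-members that are tuples,
     which [power_bound] confines to a set. *)
  edestruct (function_from_exists (push (push (push (world0 r) r) ar) M))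
    with (R := fun R jn => exists n i, pair_in R n ar /\ pair_in R i r /\
                 is_class jn (fun b => maps b n M /\ b ∈- i)) (A := P)
    as [rn [Bn [Hrn [_ Hrn']]]]; [intros; define|exact P_crisp| |].
  { intros R HR. destruct (maps_total _ _ _ _ Hr HR) as [i Hi], (arity R HR) as [n Hn].
    destruct (power_bound n M) as [u Hu].
    edestruct (mk_class (push (push (push (world0 i) i) n) M))
      with (P := fun b => maps b n M /\ b ∈- i) (u := u) as [jn Hjn];
      [intros; define|intros z [Hz _]; auto|].
    exists jn. split; [eauto|]. intros j [n' [i' [Hn' [Hi' Hj]]]].
    rewrite (maps_functional _ _ _ _ _ _ Hr Hi' Hi), (arity_unique _ _ _ Hn' Hn) in Hj.
    eapply eq_classes; eassumption. }
  edestruct (relation_exists (world0 M)) with (R := fun x y : V => x = y) (M := M)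
    as [ep [Hep Hep']]; [intros; define|exact HM|].
  edestruct (relation_exists (world0 M)) with (R := eql_neg V) (M := M)
    as [en [Hen Hen']]; [intros; define|exact HM|].
  exists rp, rn, ep, en. split.
  - split; [now split|]. split; [exact Hc|]. split; [now exists Bp|]. split; [now exists Bn|].
    split; [|split; [exact Hep|split; [exact Hen|split]]].
    + intros R n i Hn [Hi|Hi].
      * apply Hrp' in Hi. destruct Hi as [_ [j [Hj Hi]]].
        split; [eapply class_crisp, Hi|]. intros b. split.
        -- intros Hb. apply Hi in Hb. now apply (Hval R n j).
        -- intros Hb. apply Hi. intros Hb'. now apply Hb, (Hval R n j).
      * apply Hrn' in Hi. destruct Hi as [_ [n' [j [Hn' [Hj Hi]]]]].
        rewrite (arity_unique _ _ _ Hn' Hn) in Hi.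
        split; [eapply class_crisp, Hi|]. intros b. split.
        -- intros Hb. now apply Hi in Hb.
        -- intros Hb. apply Hi. tauto.
    + intros a b Hab. apply Hen'. apply Hen' in Hab. destruct Hab as [Ha [Hb Hab]].
      split; [exact Hb|]. split; [exact Ha|]. now apply eql_neg_sym.
    + intros a b Ha Hb. rewrite Hep'. tauto.
  - intros phi a Hphi Ha.
    assert (Hcar : forall f, carries h f f).
    { intros f k x y Hxy. apply Hid in Hxy. destruct Hxy as [_ <-]. tauto. }
    eapply satisfied_iff_tf_satisfied with (h := h); trivial.
    + intros x x' y Hx Hx'. apply Hid in Hx, Hx'. destruct Hx as [_ ->], Hx' as [_ ->]. trivial.
    + intros y Hy. exists y. now apply Hid.
    + intros x x' y y' Hx Hy. rewrite Hep', Hen'. apply Hid in Hx, Hy.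
      destruct Hx as [Hx <-], Hy as [Hy <-]. tauto.
    + intros R. eapply maps_total, Hr.
    + intros R. eapply maps_total, Hrp.
    + intros R. eapply maps_total, Hrn.
    + intros R n i ip jn b1 b2 Hn Hi Hip Hjn Hb1 Hb2 Hb.
      assert (b1 = b2) as <-.
      { eapply maps_eq; try eassumption. intros k x. split; intros Hk.
        - apply (Hb k x x); trivial. apply Hid. split; [|trivial]. eauto using maps_cod.
        - apply (Hb k x x); trivial. apply Hid. split; [|trivial]. eauto using maps_cod. }
      apply Hrp' in Hip. destruct Hip as [_ [i' [Hi' Hip]]].
      rewrite (maps_functional _ _ _ _ _ _ Hr Hi' Hi) in Hip.
      apply Hrn' in Hjn. destruct Hjn as [_ [n' [i'' [Hn' [Hi'' Hjn]]]]].
      rewrite (maps_functional _ _ _ _ _ _ Hr Hi'' Hi), (arity_unique _ _ _ Hn' Hn) in Hjn.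
      rewrite (proj1 (Hip b1)), (proj1 (Hjn b1)). tauto.
    + split; [exact Ha|]. split; [exact Ha|]. apply Hcar.
Qed.

(* The members and non-members overlap or leave gaps exactly so that, by
   extensionality, [x' ≠ y'] holds iff [x =⁻ y] does. *)
Definition stands_for (M en x x' : V) : Prop :=
  has_members x' (fun t => exists y, y ∈+ M /\ opair_eq x y t)
    (fun t => ~ (exists u v, u ∈+ M /\ v ∈+ M /\ opair_eq u v t) \/
              exists y, pair_in y x en /\ opair_eq y x t).

(** Whatever lies outside M×M is a non-member and not a member, so a bound of M×M suffices for
    [mk_set]. *)
Lemma stands_for_exists M en x : x ∈+ M -> exists x', stands_for M en x x'.
Proof.
  intros Hx. destruct (product_bound M M) as [u Hu].
  eapply (mk_set (push (push (push (world0 M) M) en) x)) with (u := u).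
  - intros. define.
  - intros. define.
  - intros z [[y [Hy Hz]]|Hz]; [eauto|].
    destruct (classic (exists a b, a ∈+ M /\ b ∈+ M /\ opair_eq a b z)) as [K|K]; [|tauto].
    destruct K as [a [b [Ha [Hb K]]]]. eauto.
Qed.

(** The pair (x,x) belongs to [z], and all members of [z] have first component y. *)
Lemma stands_for_injective M en x y z :
  x ∈+ M -> stands_for M en x z -> stands_for M en y z -> x = y.
Proof.
  intros Hx H K. destruct (opair_exists x x) as [p Hp].
  assert (Hpz : p ∈+ z) by (apply H; eauto).
  apply K in Hpz. destruct Hpz as [v [_ Hpz]]. now destruct (opair_inj _ _ _ _ _ Hp Hpz).
Qed.

Lemma stands_for_eql_neg M en x y x' y' : x ∈+ M -> y ∈+ M ->
  (forall a b, pair_in a b en -> pair_in b a en) ->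
  stands_for M en x x' -> stands_for M en y y' ->
  (eql_neg V x' y' <-> pair_in x y en).
Proof.
  intros Hx Hy Hsym Hx' Hy'.
  (* One direction of inequality: membership in [u'] fixes the first component of a witness as u,
     non-membership in [v'] the second as v, so the witness is (u,v). Extensionality allows either
     direction, which is where symmetry of [en] enters. *)
  assert (K : forall u v u' v', u ∈+ M -> v ∈+ M -> stands_for M en u u' ->
    stands_for M en v v' -> ((exists z, z ∈+ u' /\ z ∈- v') <-> pair_in u v en)).
  { intros u v u' v' Hu Hv Hu' Hv'. split.
    - intros [z [Hz Hz']]. apply Hu' in Hz. apply Hv' in Hz'.
      destruct Hz as [s [Hs Hz]]. destruct Hz' as [Hz'|[t [Ht Hz']]].
      + elim Hz'. now exists u, s.
      + now destruct (opair_inj _ _ _ _ _ Hz Hz') as [-> _].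
    - intros H. destruct (opair_exists u v) as [p Hp]. exists p.
      split; [apply Hu'|apply Hv'; right]; eauto. }
  rewrite (proj2 (extensionality x' y')). split.
  - intros [z [Hz|Hz]]; [|apply Hsym]; eapply K; eauto.
  - intros H. apply (K x y x' y') in H; trivial. destruct H as [z Hz]. eauto.
Qed.

(** A single a' serves all formulas, because the premises and the conclusion of a consequence are
    evaluated at the same assignment. *)
Lemma tarski_model_of_tf_model M c rp rn ep en : is_tf_model C P ar M c rp rn ep en ->
  exists M' c' r', is_tarski_model C P ar M' c' r' /\
    forall a, is_assignment M a -> exists a', is_assignment M' a' /\
      forall phi, is_formula C P ar phi ->
        (satisfied C P ar M' c' r' phi a' <-> tf_satisfied C P ar M c rp rn ep en phi a).
Proof.
  intros [[HM [m0 Hm0]] [Hc [[Bp Hrp] [[Bn Hrn] [Hrel [Hep [Hen [Hsym Hid]]]]]]]].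
  edestruct (image (push (push (world0 M) M) en)) with (R := stands_for M en) (u := M)
    as [M' HM'].
  { intros. unfold stands_for. define. }
  { intros x y z _. apply eq_members. }
  assert (CM' := class_crisp _ _ HM').
  (* The bijection leads from the Tarski domain to the T/F-domain, hence from each stand-in back to
     its original. *)
  edestruct (function_exists (push (push (world0 M) M) en))
    with (R := fun x' x => x ∈+ M /\ stands_for M en x x') (A := M') (B := M)
    as [h [Hh Hh']]; [intros; unfold stands_for; define|exact CM'|exact HM| |].
  { intros x' Hx'. apply HM' in Hx'. destruct Hx' as [x [Hx Hx']]. exists x.
    split; [exact Hx|]. split; [now split|]. intros y [Hy Hy'].
    eapply stands_for_injective; eassumption. }
  assert (Hinj : forall x x' y, pair_in x y h -> pair_in x' y h -> x = x').
  { intros x x' y Hx Hx'. apply Hh' in Hx, Hx'. eapply eq_members; [apply Hx|apply Hx']. }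
  assert (Hsurj : forall y, y ∈+ M -> exists x, pair_in x y h).
  { intros y Hy. destruct (stands_for_exists M en y Hy) as [y' Hy']. exists y'.
    apply Hh'. split; [apply HM'; eauto|tauto]. }
  destruct (carry_back _ _ _ CM' Hh Hinj Hsurj c C Hc) as [c' [Hc' Hcc]].
  (* The value at R has its members pulled back from R⁺ and its non-members from R⁻, independently.
     All non-tuples are added to the non-members, as strong inclusion in the tuples over M'
     requires. *)
  edestruct (function_from_exists (push (push (push (push (push (push (world0 h) h) ar) rp) rn) M) M'))
    with (R := fun R i => exists n ip jn, pair_in R n ar /\ pair_in R ip rp /\ pair_in R jn rn /\
      has_members i
        (fun b => maps b n M' /\ exists d, maps d n M /\ carries h b d /\ d ∈+ ip)
        (fun b => ~ maps b n M' \/ exists d, maps d n M /\ carries h b d /\ d ∈+ jn)) (A := P)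
    as [r' [B [Hr [_ Hr']]]]; [intros; unfold carries; define|exact P_crisp| |].
  { intros R HR. destruct (arity R HR) as [n Hn], (maps_total _ _ _ _ Hrp HR) as [ip Hip],
      (maps_total _ _ _ _ Hrn HR) as [jn Hjn], (power_bound n M') as [u Hu].
    edestruct (mk_set (push (push (push (push (push (push (world0 h) h) n) ip) jn) M) M'))
      with (P := fun b => maps b n M' /\ exists d, maps d n M /\ carries h b d /\ d ∈+ ip)
        (Q := fun b => ~ maps b n M' \/ exists d, maps d n M /\ carries h b d /\ d ∈+ jn) (u := u)
      as [i Hi]; [intros; unfold carries; define|intros; unfold carries; define| |].
    - intros z [[Hz _]|Hz]; [auto|]. apply Hu. apply NNPP. tauto.
    - exists i. split; [exists n, ip, jn; auto|]. intros j [n' [ip' [jn' [Hn' [Hip' [Hjn' Hj]]]]]].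
      rewrite (arity_unique _ _ _ Hn' Hn), (maps_functional _ _ _ _ _ _ Hrp Hip' Hip),
        (maps_functional _ _ _ _ _ _ Hrn Hjn' Hjn) in Hj.
      eapply eq_members; eassumption. }
  exists M', c', r'. split.
  - split; [split; [exact CM'|]|split; [exact Hc'|split; [now exists B|]]].
    + destruct (Hsurj m0 Hm0) as [m Hm]. exists m. eauto using maps_dom.
    + intros R n i Hn Hi. apply Hr' in Hi.
      destruct Hi as [_ [n' [ip [jn [Hn' [_ [_ Hi]]]]]]].
      rewrite (arity_unique _ _ _ Hn' Hn) in Hi. intros b. split.
      * intros Hb. now apply Hi in Hb.
      * intros Hb. apply Hi. now left.
  - intros a Ha.
    destruct (assignment_back _ _ _ CM' Hh Hinj Hsurj a Ha) as [a' Ha'].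
    exists a'. split; [apply Ha'|]. intros phi Hphi.
    eapply satisfied_iff_tf_satisfied with (h := h); trivial.
    + intros x x' y y' Hx Hy. apply Hh' in Hx, Hy.
      destruct Hx as [_ [Hx Hxx]], Hy as [_ [Hy Hyy]].
      rewrite (stands_for_eql_neg M en x' y' x y Hx Hy Hsym Hxx Hyy), (Hid _ _ Hx Hy).
      split; [|tauto]. split.
      * intros <-. eapply eq_members; eassumption.
      * intros <-. eapply stands_for_injective; eassumption.
    + intros R. eapply maps_total, Hr.
    + intros R. eapply maps_total, Hrp.
    + intros R. eapply maps_total, Hrn.
    + intros R n i ip jn b1 b2 Hn Hi Hip Hjn Hb1 Hb2 Hb.
      apply Hr' in Hi. destruct Hi as [_ [n' [ip' [jn' [Hn' [Hip' [Hjn' Hi]]]]]]].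
      rewrite (arity_unique _ _ _ Hn' Hn), (maps_functional _ _ _ _ _ _ Hrp Hip' Hip),
        (maps_functional _ _ _ _ _ _ Hrn Hjn' Hjn) in Hi.
      destruct (Hi b1) as [-> ->].
      assert (Hu : forall d, maps d n M -> carries h b1 d -> d = b2).
      { intros d Hd Hbd. exact (carries_unique_r _ _ _ Hh Hsurj _ _ _ _ _ _ Hb1 Hd Hb2 Hbd Hb). }
      split; split.
      * intros [_ [d [Hd [Hbd K]]]]. now rewrite <- (Hu d Hd Hbd).
      * intros K. eauto.
      * intros [K|[d [Hd [Hbd K]]]]; [tauto|]. now rewrite <- (Hu d Hd Hbd).
      * intros K. eauto.
Qed.

Definition tarski_entails (Sigma phi : V) : Prop :=
  forall M c r a, is_tarski_model C P ar M c r -> is_assignment M a ->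
    (forall psi, psi ∈+ Sigma -> satisfied C P ar M c r psi a) ->
    satisfied C P ar M c r phi a.

Definition tf_entails (Sigma phi : V) : Prop :=
  forall M c rp rn ep en a, is_tf_model C P ar M c rp rn ep en -> is_assignment M a ->
    (forall psi, psi ∈+ Sigma -> tf_satisfied C P ar M c rp rn ep en psi a) ->
    tf_satisfied C P ar M c rp rn ep en phi a.

Lemma tarski_entails_iff_tf_entails Sigma phi :
  (forall psi, psi ∈+ Sigma -> is_formula C P ar psi) -> is_formula C P ar phi ->
  (tarski_entails Sigma phi <-> tf_entails Sigma phi).
Proof.
  intros HS Hphi. split.
  - intros H M c rp rn ep en a HM Ha K.
    destruct (tarski_model_of_tf_model _ _ _ _ _ _ HM) as [M' [c' [r' [HM' E]]]].
    destruct (E a Ha) as [a' [Ha' E']]. apply E'; trivial.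
    apply H; trivial. intros psi Hpsi. apply E'; auto.
  - intros H M c r a HM Ha K.
    destruct (tf_model_of_tarski_model _ _ _ HM) as [rp [rn [ep [en [HM' E]]]]].
    apply E; trivial. apply H; trivial. intros psi Hpsi. apply E; auto.
Qed.

End Adequacy.

(** * Truth of the internal statement *)

Lemma truth_vocabulary w C P ar C_ P_ ar_ :
  denotes w C C_ -> denotes w P P_ -> denotes w ar ar_ ->
  truth w (vocabulary C P ar)
    (crisp C_ /\ crisp P_ /\ exists o, is_class o in_omega /\ maps ar_ P_ o).
Proof. intros. unfold vocabulary. sem. Qed.

Lemma truth_tarski_consequence w C P ar S phi C_ P_ ar_ S_ phi_ :
  denotes w C C_ -> denotes w P P_ -> denotes w ar ar_ -> denotes w S S_ ->
  denotes w phi phi_ ->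
  truth w (tarski_consequence C P ar S phi) (tarski_entails C_ P_ ar_ S_ phi_).
Proof. intros. unfold tarski_consequence, tarski_entails. sem. Qed.

Lemma truth_BS4_consequence w C P ar S phi C_ P_ ar_ S_ phi_ :
  denotes w C C_ -> denotes w P P_ -> denotes w ar ar_ -> denotes w S S_ ->
  denotes w phi phi_ ->
  truth w (BS4_consequence C P ar S phi) (tf_entails C_ P_ ar_ S_ phi_).
Proof. intros. unfold BS4_consequence, tf_entails. sem. Qed.

Hint Resolve truth_vocabulary truth_tarski_consequence truth_BS4_consequence : sem.

(** The search turns the formula into its truth condition, a statement about [V] that follows from
    the equality of the two entailments. *)
Lemma truth_adequacy w :
  truth w (∀ C P ar, vocabulary C P ar ⟶
    ∀ Sigma, subcls (elts Sigma) (formula C P ar) ⟶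
    ∀ phi, formula C P ar phi ⟶
      (tarski_consequence C P ar Sigma phi ⟷ BS4_consequence C P ar Sigma phi)) True.
Proof.
  eapply truth_iff; [unfold elts; sem|]. split; [trivial|].
  intros _ C P ar [HC [HP [o [_ Har]]]] Sigma HS phi Hphi.
  eapply tarski_entails_iff_tf_entails; eauto. intros psi Hpsi. now apply HS.
Qed.

End Model.

Theorem theorem10p3 :
  BS4_proves BZFC (close (
    ∀ C P ar, vocabulary C P ar ⟶
    ∀ Sigma, subcls (elts Sigma) (formula C P ar) ⟶
    ∀ phi, formula C P ar phi ⟶
      (tarski_consequence C P ar Sigma phi ⟷ BS4_consequence C P ar Sigma phi)))%bs4.
Proof.
  intros V V_theory e. apply (truth_adequacy V V_theory (0, e)). trivial.
Qed.
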